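(* Let $t>0$ be an integer. There is a constant $C_t$ such that the following holds. Let $P$ be a star-shaped polygon and let $V$ be a set of $n$ points on its boundary. If the visibility graph of $V$ with respect to $P$ does not contain $K_{t,t}$ as a subgraph, then it has at most $C_t n$ edges.
   Context: A simple polygon $P$ is star-shaped if it contains a point that sees every point of $P$. Two points $p,q\in P$ see each other (are mutually visible) if the segment $\overline{pq}$ is disjoint from the exterior of $P$. The visibility graph of a set $V$ of points on the boundary of $P$ with respect to $P$ has vertex set $V$, with two points adjacent iff they are mutually visible. *)

(* Defs.v *)
From HB Require Import structures.
From mathcomp Require Import all_boot all_order all_algebra.
From mathcomp Require Import all_classical all_reals all_analysis.
Set Implicit Arguments. Unset Strict Implicit. Unset Printing Implicit Defensive.
Import Order.TTheory GRing.Theory Num.Theory.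
Import numFieldNormedType.Exports.
Local Open Scope ring_scope.
Local Open Scope classical_set_scope.

Section Geom.
Context {R : realType}.
Notation pt := (R * R)%type.

Definition origin : pt := (0, 0).

Definition lerp (a b : pt) (l : R) : pt :=
  ((1 - l) * a.1 + l * b.1, (1 - l) * a.2 + l * b.2).

Definition segment (a b : pt) : set pt := [set lerp a b l | l in `[0, 1]].

Definition pedge (s : seq pt) (i : nat) : set pt :=
  segment (nth origin s i) (nth origin s (i.+1 %% size s)).

Definition simple_polygon (s : seq pt) : Prop :=
  (3 <= size s)%N /\ uniq s /\
  forall i j, (i < size s)%N -> (j < size s)%N -> i <> j ->
    pedge s i `&` pedge s j =
      if j == (i.+1 %% size s)%N then [set nth origin s j]
      else if i == (j.+1 %% size s)%N then [set nth origin s i]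
      else set0.

Definition pboundary (s : seq pt) : set pt :=
  [set x | exists2 i, (i < size s)%N & pedge s i x].

(* exterior of the polygon: the unbounded connected component of the
   complement of the boundary, i.e. points from which one can travel
   arbitrarily far along continuous paths avoiding the boundary *)
Definition pexterior (s : seq pt) : set pt :=
  [set y | ~ pboundary s y /\
    forall M : R, exists g : R -> pt,
      [/\ {within `[0, 1], continuous g}, g 0 = y,
          (forall u, 0 <= u <= 1 -> ~ pboundary s (g u)) &
          M < `|(g 1).1| + `|(g 1).2| ] ].

Definition pregion (s : seq pt) : set pt := ~` pexterior s.

Definition sees (s : seq pt) (p q : pt) : Prop :=
  segment p q `&` pexterior s = set0.

Definition star_shaped (s : seq pt) : Prop :=
  exists2 c, pregion s c & forall p, pregion s p -> sees s c p.

Definition vis_edges (s : seq pt) (V : seq pt) : nat :=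
  #|[set ij : 'I_(size V) * 'I_(size V) |
      (ij.1 < ij.2)%N && `[< sees s (nth origin V ij.1) (nth origin V ij.2) >]]|.

Definition vis_has_Ktt (s : seq pt) (V : seq pt) (t : nat) : Prop :=
  exists A B : {set 'I_(size V)},
    [/\ #|A| = t, #|B| = t, (A :&: B = finset.set0) &
        forall i j, i \in A -> j \in B -> sees s (nth origin V i) (nth origin V j)].

End Geom.

(* Main.v *)
(** Let [o] be a point of the kernel. A simple polygon is the frontier of its exterior, so no
    boundary point lies inside a triangle [o a c] whose side [a c] is visible. Hence, if [a, b, c, d] come
    in this angular order around [o], within a half-turn, and [a] sees [c] and [b] sees [d],
    then [a] sees [d], since the segment [a d] lies in the union of the triangles [o a c], [o b d].

    Cut the plane along a line through [o]. Between two points of the same half-plane,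
    an edge that is neither among the [t] longest to its left nor among the [t] longest to its
    right produces a [K_{t,t}]. For edges across the cut turning counterclockwise by less
    than a half-turn, the graph has a vertex of degree at most [2t], and so does every
    subgraph. Points on a line through [o] see each other, so there are at most [2t] of them. *)

(* The angular order around [o] is transitive only within a half-turn, which is why the plane is cut
   before any counting. On one side of the cut a lengthened edge still spans less than a half-turn,
   so the exchange rule of the overview always applies and the longest edges can be counted
   directly. Across the cut, lengthening may exceed a half-turn, and the triangle at [o] is lost.
   There the rule is used for [a d] only when some [a0] before [a] already has the edge [a0 d],
   which bounds the angle. This weaker rule yields only convexity of certain neighbourhoods, hence
   the detour through vertices of small degree.

   The frontier fact is obtained without the Jordan curve theorem: only the adherence of the
   boundary to the exterior is proved. Near each of its points the boundary is a pair of segments,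
   so an exterior that reaches the point reaches all nearby boundary points, and adherence spreads
   around the closed curve. *)
From mathcomp Require Import all_boot zify.
Set Implicit Arguments. Unset Strict Implicit. Unset Printing Implicit Defensive.

(** * Ordered graphs without large bicliques *)

Section Combinatorics.
Variable I : finType.
Implicit Types (E : rel I) (A B X Y : {set I}) (k : I -> nat) (t : nat).

Definition degr E B (a : I) := #|[set b in B | E a b]|.
Definition degl E A (b : I) := #|[set a in A | E a b]|.
Definition edges_between E A B := #|[set p in setX A B | E p.1 p.2]|.
(** The two sides may overlap here. In the application [E] is irreflexive, so a complete pair is
    automatically disjoint, as [vis_has_Ktt] demands. *)
Definition biclique_free E t := forall X Y, #|X| = t -> #|Y| = t ->
  ~ {in X & Y, forall x y, E x y}.

Lemma edges_between_row E A B : edges_between E A B = \sum_(a in A) degr E B a.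
Proof.
rewrite /edges_between -sum1_card.
rewrite (eq_bigl (fun p : I * I => (p.1 \in A) && ((p.2 \in B) && E p.1 p.2))); last first.
  by move=> p; rewrite !inE andbA.
rewrite -(pair_big_dep (mem A) (fun a b => (b \in B) && E a b) (fun _ _ => 1)) /=.
by apply: eq_bigr => a _; rewrite /degr -sum1_card; apply: eq_bigl => b; rewrite inE.
Qed.

Lemma edges_between_col E A B : edges_between E A B = \sum_(b in B) degl E A b.
Proof.
rewrite edges_between_row.
under eq_bigr do rewrite /degr -sum1_card.
under [RHS]eq_bigr do rewrite /degl -sum1_card.
rewrite (exchange_big_dep (mem B)) /=; last by move=> a b _; rewrite inE => /andP[].
by apply: eq_bigr => b bB; apply: eq_bigl => a; rewrite !inE bB.
Qed.

(** The member of the counted set with the largest key has all other members among its fewer than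
    [t] predecessors. *)
Lemma card_few_below X k (t : nat) : {in X &, injective k} ->
  #|[set b in X | #|[set a in X | k a < k b]| < t]| <= t.
Proof.
move=> kinj; set Z := [set b in X | _].
have [->|/set0Pn[z zZ]] := eqVneq Z set0; first by rewrite cards0.
have [b bZ bmax] := arg_maxnP k zZ.
have {bZ} bZ : b \in Z := bZ.
have bX : b \in X by move: bZ; rewrite inE => /andP[].
have : Z :\ b \subset [set a in X | k a < k b].
  apply/subsetP => a /setD1P[ab aZ]; have aX : a \in X by move: aZ; rewrite inE => /andP[].
  have /= kab := bmax a aZ; rewrite inE aX /= ltn_neqAle [k a <= _]kab andbT.
  by apply: contraNneq ab => /kinj-> .
move/subset_leq_card; rewrite (cardsD1 b Z) bZ.
by move: bZ; rewrite inE => /andP[_]; lia.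
Qed.

(** Column by column this is [card_few_below]. With keys in angular order, the smallest neighbours
    of an endpoint are the far ends of its longest edges. *)
Lemma few_below_edges E A B k t : {in A &, injective k} ->
  #|[set p in setX A B | E p.1 p.2 & #|[set a in A | E a p.2 & k a < k p.1]| < t]|
    <= t * #|B|.
Proof.
move=> kinj; pose F : rel I := fun a b => E a b && (#|[set a' in A | E a' b & k a' < k a]| < t).
have -> : [set p in setX A B | E p.1 p.2 & #|[set a in A | E a p.2 & k a < k p.1]| < t] =
          [set p in setX A B | F p.1 p.2] by apply/setP => p; rewrite !inE.
rewrite -/(edges_between F A B) edges_between_col mulnC -sum_nat_const leq_sum// => b _.
rewrite /degl; set X := [set a in A | E a b].
apply: leq_trans (@card_few_below X k t _); last first.
  by move=> x y; rewrite !inE => /andP[xA _] /andP[yA _]; apply: kinj.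
apply: eq_leq; apply: eq_card => a; rewrite !inE /F -andbA; congr [&& _, _ & _ < _].
by apply: eq_card => a'; rewrite !inE andbA.
Qed.

Lemma exists_subset_card X t : t <= #|X| -> exists2 Y : {set I}, Y \subset X & #|Y| = t.
Proof.
move=> tX; have [s s1 [s2 s3]] : exists2 s : seq I, uniq s & size s = t /\ (forall x, x \in s -> x \in X).
  exists (take t (enum X)); first by rewrite take_uniq// enum_uniq.
  split; first by rewrite size_takel// -cardE.
  by move=> x /mem_take; rewrite mem_enum.
exists [set x in s]; first by apply/subsetP => x; rewrite inE => /s3.
by rewrite cardsE (card_uniqP s1).
Qed.

Lemma biclique_free_le E t X Y : biclique_free E t -> t <= #|X| -> t <= #|Y| ->
  ~ {in X & Y, forall x y, E x y}.
Proof.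
move=> Efree /exists_subset_card[X' /subsetP X'X cX] /exists_subset_card[Y' /subsetP Y'Y cY] XY.
by apply: (Efree X' Y') => // x y /X'X ? /Y'Y; apply: XY.
Qed.

(* An edge [b c] that is neither among the [t] longest to the left of [c] nor among the
   [t] longest to the right of [b] yields a biclique on the ends of those longer edges. *)
Lemma capped_edges_le E A B k1 k2 t :
  {in A &, injective k1} -> {in B &, injective k2} ->
  (forall a b c d, a \in A -> b \in A -> c \in B -> d \in B ->
     k1 a < k1 b -> k2 d < k2 c -> E a c -> E b d -> E b c -> E a d) ->
  biclique_free E t ->
  edges_between E A B <= t * (#|A| + #|B|).
Proof.
move=> k1i k2i cap Efree.
pose Z1 := [set p in setX A B | E p.1 p.2 & #|[set a in A | E a p.2 & k1 a < k1 p.1]| < t].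
pose Z2 := [set p in setX B A | E p.2 p.1 & #|[set d in B | E p.2 d & k2 d < k2 p.1]| < t].
have c1 : #|Z1| <= t * #|B| by exact: few_below_edges.
have c2 : #|Z2| <= t * #|A| by exact: (@few_below_edges (fun x y => E y x)).
pose sw (p : I * I) := (p.2, p.1).
have c3 : #|sw @^-1: Z2| = #|Z2|.
  by apply: on_card_preimset; exists sw => -[].
suff : [set p in setX A B | E p.1 p.2] \subset Z1 :|: sw @^-1: Z2.
  move/subset_leq_card/leq_trans; apply; rewrite cardsU c3; nia.
apply/subsetP => -[b c]; rewrite !inE /= => /andP[/andP[bA cB] bc].
rewrite bA cB bc /=; apply/orP; case: ltnP => [_|h1]; [by left|right].
rewrite ltnNge; apply/negP => h2; apply: (biclique_free_le Efree h1 h2) => a d.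
rewrite !inE => /and3P[aA ac ab] /and3P[dB bd dc].
exact: (cap a b c d).
Qed.

(** Removing a vertex of degree at most [m] loses at most [m] edges, and the assumption passes to
    subsets, so vertices are peeled off one at a time. *)
Lemma degenerate_edges_le E (m : nat) A B :
  (forall A' B', A' \subset A -> B' \subset B -> (0 < #|A'| + #|B'|) ->
     (exists2 a, a \in A' & degr E B' a <= m) \/ (exists2 b, b \in B' & degl E A' b <= m)) ->
  edges_between E A B <= m * (#|A| + #|B|).
Proof.
move: {2}(#|A| + #|B|) (erefl (#|A| + #|B|)) => n; elim: n A B => [|n IH] A B.
  move=> /eqP; rewrite addn_eq0 !cards_eq0 => /andP[/eqP-> _] _.
  by rewrite edges_between_row big_set0.
move=> cAB low; have [//|//||[a aA da]|[b bB db]] := low A B _ _ _; first by rewrite cAB.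
- have cA := cardsD1 a A; rewrite aA /= in cA.
  have := IH (A :\ a) B ltac:(lia) (fun A' B' sA => low A' B' (subset_trans sA (subD1set _ _))).
  rewrite [edges_between E A B]edges_between_row (big_setD1 a)//= -edges_between_row.
  by rewrite cA; nia.
- have cB := cardsD1 b B; rewrite bB /= in cB.
  have := IH A (B :\ b) ltac:(lia)
    (fun A' B' sA sB => low A' B' sA (subset_trans sB (subD1set _ _))).
  rewrite [edges_between E A B]edges_between_col (big_setD1 b)//= -edges_between_col.
  by rewrite cB; nia.
Qed.

(** Up to [z], the neighbourhood of each [d] is an interval ending at [z]. Take the [d] whose
    interval starts last: its members, at least [t] of them, lie in the intervals of all other
    elements of [D]. *)
Lemma convex_fan_biclique E A (D : {set I}) k z t : 0 < t -> {in A &, injective k} -> z \in A ->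
  (forall d, d \in D -> E z d) ->
  (forall d a0 a, d \in D -> a0 \in A -> a \in A ->
     E a0 d -> k a0 < k a -> k a < k z -> E a d) ->
  (forall d, d \in D -> t <= #|[set a in A | E a d & k a <= k z]|) ->
  t <= #|D| -> ~ biclique_free E t.
Proof.
move=> t0 kinj zA Ez conv big tD Efree.
pose lo d := [arg min_(a < z | (a \in A) && E a d) k a].
have loP d : d \in D -> [/\ lo d \in A, E (lo d) d &
    forall a, a \in A -> E a d -> k (lo d) <= k a].
  move=> dD; rewrite /lo; case: arg_minnP => [|a /andP[aA ad] amin]; first by rewrite zA Ez.
  by split=> // a' a'A a'd; apply: amin; rewrite a'A.
have /card_gt0P[d0 d0D] : 0 < #|D| by apply: leq_trans tD.
have [d1 d1D d1max] := arg_maxnP (k \o lo) d0D.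
apply: (biclique_free_le Efree (big _ d1D) tD) => a d; rewrite !inE => /and3P[aA ad1 az] dD.
have [loA lod _] := loP _ dD; have [_ _ lomin] := loP _ d1D.
have : k (lo d) <= k a := leq_trans (d1max _ dD) (lomin _ aA ad1).
rewrite leq_eqVlt => /predU1P[/kinj<-//|lt1].
move: az; rewrite leq_eqVlt => /predU1P[/kinj->//|lt2]; first exact: Ez.
exact: conv lod lt1 lt2.
Qed.

(* Take [z] whose first neighbour comes last. The neighbourhood of every neighbour of [z] is
   then convex in [A], hence contains the [t] predecessors or the [t] successors of [z]. *)
Lemma nested_edges_le E A B k1 k2 t : 0 < t ->
  {in A &, injective k1} -> {in B &, injective k2} ->
  (forall a0 a b c d, a0 \in A -> a \in A -> b \in A -> c \in B -> d \in B ->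
     k1 a0 < k1 a -> k1 a < k1 b -> k2 c < k2 d -> E a0 d -> E b d -> E a c -> E a d) ->
  biclique_free E t ->
  edges_between E A B <= t.*2 * (#|A| + #|B|).
Proof.
move=> t0 k1i k2i Q Efree; apply: degenerate_edges_le => A' B' /subsetP sA /subsetP sB ne.
have [/existsP[a /andP[aA da]]|/existsPn hA] :=
  boolP [exists a, (a \in A') && (degr E B' a <= t.*2)]; first by left; exists a.
have [/existsP[b /andP[bB db]]|/existsPn hB] :=
  boolP [exists b, (b \in B') && (degl E A' b <= t.*2)]; first by right; exists b.
exfalso; have {}hA a : a \in A' -> t.*2 < degr E B' a.
  by move=> aA; have := hA a; rewrite aA ltnNge.
have {}hB b : b \in B' -> t.*2 < degl E A' b.
  by move=> bB; have := hB b; rewrite bB ltnNge.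
have [a1 a1A] : exists a, a \in A'.
  have [A0|[a aA]] := set_0Vmem A'; last by exists a.
  rewrite A0 cards0 add0n in ne; have /card_gt0P[b bB] := ne.
  have /card_gt0P[a] : 0 < degl E A' b by apply: leq_trans (hB _ bB).
  by rewrite inE => /andP[aA _]; exists a.
(* The first neighbour of [a]. The default handed to the minimum is itself a neighbour: degrees in
   [A'] are positive, so the fallback [a] does not occur. *)
pose m a := [arg min_(b < odflt a [pick b in B' | E a b] | (b \in B') && E a b) k2 b].
have mP a : a \in A' -> [/\ m a \in B', E a (m a) &
    forall b, b \in B' -> E a b -> k2 (m a) <= k2 b].
  move=> aA; rewrite /m; case: arg_minnP => [|b /andP[bB ab] bmin].
    case: pickP => [//|none]; have /card_gt0P[b] : 0 < degr E B' a by apply: leq_trans (hA _ aA).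
    by rewrite inE none.
  by split=> // b' b'B ab'; apply: bmin; rewrite b'B.
have [z zA zmax] := arg_maxnP (k2 \o m) a1A.
(* By the choice of [z], the first neighbour of [a] comes no later than [d]. Either it is [d], or it
   serves as the [c] of the exchange hypothesis. *)
have conv d a0 a b : d \in B' -> E z d -> a0 \in A' -> a \in A' -> b \in A' ->
    E a0 d -> E b d -> k1 a0 < k1 a -> k1 a < k1 b -> E a d.
  move=> dB zd a0A aA bA a0d bd lt1 lt2.
  have [maB ama _] := mP _ aA; have [_ _ zmin] := mP _ zA.
  have : k2 (m a) <= k2 d := leq_trans (zmax _ aA) (zmin _ dB zd).
  rewrite leq_eqVlt => /predU1P[/k2i<-//|lt3]; rewrite ?sB//.
  by apply: (Q a0 a b (m a) d); rewrite ?sA ?sB.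
pose D := [set d in B' | E z d].
pose D1 := [set d in D | t <= #|[set a in A' | E a d & k1 a <= k1 z]|].
pose D2 := [set d in D | t <= #|[set a in A' | E a d & k1 z <= k1 a]|].
(* Since [d] has more than [2t] neighbours, at least [t] of them lie on one side of [z], with [z]
   itself counted on both. *)
have DU : D \subset D1 :|: D2.
  apply/subsetP => d dD; rewrite !inE -!andb_orr; move: (dD); rewrite inE => /andP[dB zd].
  rewrite dB zd /=; apply/orP; have := hB _ dB; rewrite /degl.
  have -> : [set a in A' | E a d] = [set a in A' | E a d & k1 a <= k1 z] :|:
                                   [set a in A' | E a d & k1 z <= k1 a].
    by apply/setP => a; rewrite !inE -!andb_orr leq_total !andbT.
  rewrite cardsU => h.
  by have [|l1] := leqP t #|[set a in A' | E a d & k1 a <= k1 z]|; [left|right; lia].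
have kA : {in A' &, injective k1} by move=> x y /sA xA /sA; apply: k1i.
have : t.*2 < #|D1 :|: D2| by apply: leq_trans (hA _ zA) (subset_leq_card DU).
rewrite cardsU; have [tD1 _|lt1 tD] := leqP t #|D1|.
  apply: (convex_fan_biclique t0 kA zA _ _ _ tD1 Efree) => [d|d a0 a|d].
  - by rewrite !inE => /andP[/andP[]].
  - rewrite !inE => /andP[/andP[dB zd] _] a0A aA a0d lt1 lt2; exact: (conv d a0 a z).
  - by rewrite inE => /andP[].
(* Under the reflected key [M - k1] the successors of [z] become its predecessors. *)
pose M := \max_(a : I) k1 a; have kM a : k1 a <= M by exact: leq_bigmax.
have tD2 : t <= #|D2| by lia.
apply: (@convex_fan_biclique E A' D2 (fun a => M - k1 a) z t _ _ _ _ _ _ tD2 Efree) => // [|d|d a0 a|d].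
- by move=> x y xA yA xy; apply: kA => //; have := kM x; have := kM y; lia.
- by rewrite !inE => /andP[/andP[]].
- rewrite !inE => /andP[/andP[dB zd] _] a0A aA a0d lt1' lt2'.
  by apply: (conv d z a a0) => //; have := kM z; have := kM a; have := kM a0; lia.
- rewrite inE => /andP[_ /leq_trans]; apply; apply: subset_leq_card; apply/subsetP => a.
  by rewrite !inE => /and3P[-> -> /=]; lia.
Qed.

(** The rank of [i] in [X]. It turns a comparison that is an order only on one half-plane into the
    numerical key that the counting lemmas expect. *)
Definition order_key (r : rel I) X (i : I) := #|[set j in X | r j i]|.

Lemma order_key_lt (r : rel I) X : {in X, forall i, ~~ r i i} ->
  {in X & &, transitive r} -> {in X &, forall i j, i != j -> r i j || r j i} ->
  {in X &, forall i j, (order_key r X i < order_key r X j) = r i j}.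
Proof.
move=> irr tr tot.
have mono i j : i \in X -> j \in X -> r i j -> order_key r X i < order_key r X j.
  move=> iX jX rij; apply: proper_card; apply/properP; split.
    by apply/subsetP => k; rewrite !inE => /andP[kX rki]; rewrite kX (tr i).
  by exists i; rewrite !inE iX ?rij//= irr.
move=> i j iX jX; apply/idP/idP => [lt|]; last exact: mono.
have /(tot i j iX jX)/orP[//|/(mono _ _ jX iX)] : i != j by apply: contraTneq lt => ->; rewrite ltnn.
by rewrite ltnNge ltnW.
Qed.

Lemma order_key_inj (r : rel I) X : {in X, forall i, ~~ r i i} ->
  {in X & &, transitive r} -> {in X &, forall i j, i != j -> r i j || r j i} ->
  {in X &, injective (order_key r X)}.
Proof.
move=> irr tr tot i j iX jX eqk; apply/eqP; apply: contraTT isT => /(tot i j iX jX).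
by rewrite -!(order_key_lt irr tr tot)// eqk ltnn.
Qed.

End Combinatorics.

Require Import Defs.
From mathcomp Require Import all_boot all_order all_algebra.
From mathcomp Require Import all_classical all_reals all_analysis.
From mathcomp Require Import ring lra.
Import Order.TTheory GRing.Theory Num.Theory.
Import numFieldNormedType.Exports.
Local Open Scope ring_scope.
Local Open Scope classical_set_scope.

(** * The boundary of a simple polygon adheres to its exterior *)

Section PolygonFrontier.
Variable R : realType.
Implicit Types (x y z a b : R * R) (s : seq (R * R)).

Lemma lerp0 a b : lerp a b 0 = a.
Proof. by case: a => a1 a2; rewrite /lerp/=; congr pair; ring. Qed.

Lemma lerp1 a b : lerp a b 1 = b.
Proof. by case: b => b1 b2; rewrite /lerp/=; congr pair; ring. Qed.

Lemma lerp_continuous a b : continuous (lerp a b : R -> R * R).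
Proof.
move=> l; apply: (@cvg_pair _ _ _ (nbhs l) (nbhs _) (nbhs _)) => /=;
by apply: cvgD; apply: cvgM; (try exact: cvg_cst);
  [apply: cvgB; [exact: cvg_cst|exact: cvg_id]|exact: cvg_id].
Qed.

Lemma lerpC a b (l : R) : lerp a b l = lerp b a (1 - l).
Proof. by rewrite /lerp; congr pair; ring. Qed.

Lemma segment_sym a b : segment a b = segment b a.
Proof.
by apply/seteqP; split=> _ [l /= + <-]; rewrite in_itv/= lerpC => /andP[l0 l1];
   exists (1 - l) => //=; rewrite in_itv/=; lra.
Qed.

Lemma segmentP a b z :
  segment a b z <-> exists2 l : R, 0 <= l <= 1 & lerp a b l = z.
Proof. by split=> -[l /= li <-]; exists l => //=; move: li; rewrite in_itv. Qed.

Lemma segment_closed a b : closed (segment a b).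
Proof.
apply: compact_closed; first exact: norm_hausdorff.
apply: continuous_compact; last exact: segment_compact.
exact/continuous_subspaceT/lerp_continuous.
Qed.

Lemma pboundary_closed s : closed (pboundary s).
Proof.
rewrite (_ : pboundary s = \bigcup_(i in `I_(size s)) pedge s i); last first.
  by apply/seteqP; split=> z [i ? ?]; exists i.
by apply: closed_bigcup; [exact: finite_II | move=> i _; exact: segment_closed].
Qed.

Lemma ball_lerp x (r : R) y z (l : R) :
  0 <= l <= 1 -> ball x r y -> ball x r z -> ball x r (lerp y z l).
Proof.
have bE (p q : R) : ball p r q <-> - r < p - q < r.
  by rewrite -ball_normE /ball_ /= ltr_norml.
move=> l01; have cv (p q : R) : - r < p < r -> - r < q < r ->
    - r < (1 - l) * p + l * q < r.
  by move=> pr qr; have [l0|l0] := ltP 0 l; [nra|have -> : l = 0 by lra]; lra.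
move=> [/bE y1 /bE y2] [/bE z1 /bE z2]; split; apply/bE => /=.
  by have := cv _ _ y1 z1; lra.
by have := cv _ _ y2 z2; lra.
Qed.

(** The escape path from [y] is prefixed with the segment from [z] to [y], each run at double speed
    on half of the unit interval. *)
Lemma pexterior_segment s y z : (segment z y `&` pboundary s = set0) ->
  pexterior s y -> pexterior s z.
Proof.
move=> disj [yP far]; have zP l : 0 <= l <= 1 -> ~ pboundary s (lerp z y l).
  move=> l01 Pl; suff : (segment z y `&` pboundary s) (lerp z y l) by rewrite disj.
  by split=> //; apply/segmentP; exists l.
split; first by rewrite -(lerp0 z y); apply: zP; lra.
move=> M; have [g [gc g0 gP gM]] := far M.
pose h u := if u <= 2^-1 then lerp z y (2 * u) else g (2 * u - 1).
have h0 : h 0 = z by rewrite /h ifT ?mulr0 ?lerp0//; lra.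
have h1 : h 1 = g 1 by rewrite /h ifF; [congr g; lra | apply/negbTE; rewrite -ltNge; lra].
have hg u : 2^-1 <= u -> h u = g (2 * u - 1).
  rewrite /h; case: ifPn => // u1 u2; have -> : u = 2^-1 by lra.
  by rewrite divff// subrr g0 lerp1.
exists h; split => //.
- have -> : `[0, 1]%classic = `[0, 2^-1] `|` `[2^-1, 1] :> set R.
    by apply/seteqP; split=> u /=; rewrite !in_itv/=; lra.
  apply: withinU_continuous; [exact: itv_closed | exact: itv_closed | |].
  + have hl (u : R) : u \in `[0, 2^-1]%classic -> (lerp z y \o *%R 2) u = h u.
      by rewrite inE/= in_itv/= /h => /andP[_ ->].
    apply: (subspace_eq_continuous hl); apply: continuous_subspaceT => u.
    by apply: continuous_comp; [exact: mulrl_continuous | exact: lerp_continuous].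
  + have hr (u : R) : u \in `[2^-1, 1]%classic -> (g \o (fun u => 2 * u - 1)) u = h u.
      by rewrite inE/= in_itv/= => /andP[/hg ->].
    apply: (subspace_eq_continuous hr).
    move/subspace_continuousP : gc => gc; apply/subspace_continuousP => u /=.
    rewrite in_itv/= => /andP[u1 u2].
    apply: (@cvg_comp _ _ _ _ g _ (within `[0, 1] (nbhs (2 * u - 1)))); last first.
      by apply: gc => /=; rewrite in_itv/=; lra.
    have aff : {for u, continuous (fun u : R => 2 * u - 1)}.
      rewrite /prop_for; apply: (@continuousB R R^o R ( *%R 2) (cst 1) u).
        exact: mulrl_continuous.
      exact: cst_continuous.
    move=> S /aff affS.
    change (nbhs (u : R) [set w : R | `[2^-1, 1]%classic w -> S (2 * w - 1)]).
    have FF := nbhs_filter (u : R); apply: (@filterS R (nbhs (u : R)) FF _ _ _ affS).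
    move=> w /= + w1; apply; move: w1; rewrite /= !in_itv/=; lra.
- move=> u u01; have [u2|u2] := leP u 2^-1.
    by rewrite /h u2; apply: zP; lra.
  by rewrite hg; [apply: gP; lra | lra].
- by rewrite h1.
Qed.

Lemma affine_near_gt0 (p q r : R) x : 0 < p * x.1 + q * x.2 + r ->
  \forall y \near x, 0 < p * y.1 + q * y.2 + r.
Proof.
move=> f0; have fc : {for x, continuous (fun y : R * R => p * y.1 + q * y.2 + r)}.
  apply: cvgD; last exact: cvg_cst.
  by apply: cvgD; apply: cvgM; (try exact: cvg_cst); [exact: cvg_fst | exact: cvg_snd].
have := @cvgr_gt R _ (nbhs x) _ _ _ fc 0 f0; exact.
Qed.

Lemma nbhs_lerp x v (B : set (R * R)) : nbhs x B ->
  exists2 e : R, 0 < e <= 1 & B (lerp x v e).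
Proof.
rewrite -{1}(lerp0 x v) => /(@lerp_continuous x v 0 _) /nbhs_ballP[e /= e0 eB].
have m0 : 0 < Num.min (e / 2) 1 by rewrite lt_min; lra.
exists (Num.min (e / 2) 1); first by rewrite m0 ge_min lexx orbT.
apply: eB; rewrite -ball_normE /ball_ /= sub0r normrN gtr0_norm//.
by rewrite gt_min; apply/orP; left; lra.
Qed.

Lemma closure_lerp (E : set (R * R)) z w :
  (forall l : R, 0 < l <= 1 -> E (lerp z w l)) -> closure E z.
Proof. by move=> zw B /(nbhs_lerp w)[e e01 Be]; exists (lerp z w e); split; [exact: zw|]. Qed.

(** The complement of the boundary is explored through convex pieces, in which a straight segment
    joins any two points. *)
Lemma pexterior_convex s (S : set (R * R)) :
  (forall y z l, 0 <= l <= 1 -> S y -> S z -> S (lerp y z l)) ->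
  (forall y, S y -> ~ pboundary s y) ->
  forall y, S y -> pexterior s y -> S `<=` pexterior s.
Proof.
move=> Scv SP y Sy Ey z Sz; apply: pexterior_segment Ey.
by rewrite -subset0 => w [/segmentP[l l01 <-]]; apply: SP; exact: Scv.
Qed.

Lemma notin_pboundary_ball s y : ~ pboundary s y ->
  exists2 r : R, 0 < r & forall z, ball y r z -> ~ pboundary s z.
Proof.
move=> yP; have /nbhs_ballP[r r0 rB] : nbhs y (~` pboundary s).
  by apply: open_nbhs_nbhs; split=> //; apply: closed_openC; exact: pboundary_closed.
by exists r.
Qed.

Lemma pexterior_nbhs s y : pexterior s y -> nbhs y (pexterior s).
Proof.
move=> Ey; have [r r0 rP] := notin_pboundary_ball Ey.1.
apply/nbhs_ballP; exists r => //=; apply: pexterior_convex Ey; last exact: ballxx.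
  by move=> *; exact: ball_lerp.
exact: rP.
Qed.

Lemma closure_pexterior s y : closure (pexterior s) y -> ~ pboundary s y -> pexterior s y.
Proof.
move=> cy /notin_pboundary_ball[r r0 rP].
have [w [Ew yw]] := cy _ (nbhsx_ballx y r r0).
apply: (pexterior_convex _ rP yw Ew); last exact: ballxx.
by move=> *; exact: ball_lerp.
Qed.

Lemma segment_clopen (K : set (R * R)) a b : closed K ->
  (forall x, segment a b x -> K x -> \forall y \near x, segment a b y -> K y) ->
  forall x, segment a b x -> K x -> segment a b `<=` K.
Proof.
move=> Kc Ko x abx Kx.
have conn : connected (segment a b).
  apply: connected_continuous_connected; first exact: segment_connected.
  exact/continuous_subspaceT/lerp_continuous.
suff <- : segment a b `&` K = segment a b by move=> y [].
apply: conn; first by exists x.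
- exists [set y | segment a b y -> K y]°; first exact: open_interior.
  apply/seteqP; split=> y [aby]; first by move=> Ky; split=> //; exact: Ko.
  by move=> /interior_subset Ky; split=> //; exact: Ky.
- by exists K.
Qed.

Lemma pboundary_nth s i : (i < size s)%N -> pboundary s (nth origin s i).
Proof. by move=> si; exists i => //; exists 0 => /=; rewrite ?lerp0// in_itv/= lexx ler01. Qed.

Lemma pboundary_bounded s : exists2 M : R, 0 <= M & forall z, pboundary s z -> z.1 <= M.
Proof.
pose M := \sum_(v <- s) `|v.1|.
have Mv v : v \in s -> `|v.1| <= M.
  by move=> vs; rewrite /M (big_rem v)//= lerDl sumr_ge0.
exists M; first by rewrite sumr_ge0.
move=> z [i si /segmentP[l l01 <-]] /=.
have s0 : (0 < size s)%N by apply: leq_ltn_trans si.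
have := Mv _ (mem_nth origin si); have := Mv _ (mem_nth origin (ltn_pmod i.+1 s0)).
rewrite !ler_norml; nra.
Qed.

Lemma pexterior_nonempty s : exists e, pexterior s e.
Proof.
have [M M0 MP] := pboundary_bounded s; exists (M + 1, 0).
have far (z : R * R) : M < z.1 -> ~ pboundary s z.
  by move=> Mz /MP; rewrite leNgt Mz.
split; first by apply: far => /=; lra.
move=> N; exists (lerp (M + 1, 0) (M + 1 + `|N|, 0)); split.
- exact/continuous_subspaceT/lerp_continuous.
- exact: lerp0.
- by move=> u u01; apply: far => /=; have := normr_ge0 N; nra.
- rewrite lerp1 /= normr0 addr0; have := ler_norm N; have := normr_ge0 N.
  by move=> ? ?; rewrite ger0_norm; lra.
Qed.

(** Otherwise the exterior would be both open and closed, and a segment from an exterior point to a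
    vertex could never leave it. *)
Lemma pboundary_closure_nonempty s : (0 < size s)%N ->
  exists2 x, pboundary s x & closure (pexterior s) x.
Proof.
move=> s0; have [e Ee] := pexterior_nonempty s.
set p := nth origin s 0; have Pp : pboundary s p by exact: pboundary_nth.
apply: contrapT => none.
have cP x : closure (pexterior s) x -> pexterior s x.
  by move=> cx; apply: closure_pexterior => // Px; apply: none; exists x.
suff : segment e p `<=` closure (pexterior s).
  move=> /(_ p) h; apply: none; exists p => //; apply: h.
  by apply/segmentP; exists 1; rewrite ?lerp1// ler01 lexx.
apply: (@segment_clopen _ _ _ _ _ e).
- exact: closed_closure.
- move=> x _ /cP/pexterior_nbhs; apply: filterS => y Ey _; exact: subset_closure.
- by apply/segmentP; exists 0; rewrite ?lerp0// ler01 lexx.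
- exact: subset_closure.
Qed.

(** * Local pictures: two segments leaving a common point *)

Implicit Types u v w : R * R.

(** Twice the signed area of the triangle [x u v], positive when the turn from [u] to [v] about [x]
    is counterclockwise and less than a half-turn. Being affine in [u] and in [v], it provides
    coordinates by ratios. *)
Definition orient x u v : R :=
  (u.1 - x.1) * (v.2 - x.2) - (u.2 - x.2) * (v.1 - x.1).

Lemma conv_gt0 (l p q : R) : 0 <= l <= 1 -> 0 < p -> 0 < q -> 0 < (1 - l) * p + l * q.
Proof.
by move=> l01 p0 q0; have [l0|l0] := ltP 0 l; [nra|have -> : l = 0 by lra]; lra.
Qed.

Lemma conv_gt0r (l p q : R) : 0 < l <= 1 -> 0 <= p -> 0 < q -> 0 < (1 - l) * p + l * q.
Proof. by move=> l01 p0 q0; nra. Qed.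

Lemma orient_lerpr x u y z l :
  orient x u (lerp y z l) = (1 - l) * orient x u y + l * orient x u z.
Proof. by rewrite /orient /=; ring. Qed.

Lemma orient_lerpl x u y z l :
  orient x (lerp y z l) u = (1 - l) * orient x y u + l * orient x z u.
Proof. by rewrite /orient /=; ring. Qed.

Lemma orient_near_lt x u (c : R) : 0 < c -> \forall y \near x, orient x u y < c.
Proof.
move=> c0; have : \forall y \near x, 0 < (u.2 - x.2) * y.1 + (x.1 - u.1) * y.2 +
    (c - (u.2 - x.2) * x.1 - (x.1 - u.1) * x.2).
  by apply: affine_near_gt0; lra.
by apply: filterS => y; rewrite /orient; lra.
Qed.

Lemma orientC x u v : orient x u v = - orient x v u.
Proof. by rewrite /orient; ring. Qed.

Definition dotd x u v : R := (u.1 - x.1) * (v.1 - x.1) + (u.2 - x.2) * (v.2 - x.2).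

Lemma dotdC x u v : dotd x u v = dotd x v u.
Proof. by rewrite /dotd; ring. Qed.

Lemma dotd_gt0 x u : u <> x -> 0 < dotd x u u.
Proof.
move=> ux; rewrite /dotd -!expr2 lt_def addr_ge0 ?sqr_ge0// andbT.
apply: contra_notN ux; rewrite paddr_eq0 ?sqr_ge0// !sqrf_eq0 !subr_eq0.
by case: u x => ? ? [? ?] /= /andP[/eqP-> /eqP->].
Qed.

(** The parameter is that of the orthogonal projection of [y] on the line through [x] and [u], which
    fixes the points of that line. *)
Lemma lerp_dotd x u y : orient x u y = 0 -> 0 < dotd x u u ->
  lerp x u (dotd x u y / dotd x u u) = y.
Proof.
pose dt := dotd x; pose sq u := dotd x u u; rewrite -/(sq u) -/(dt u y).
move=> o0 su; have sun : sq u != 0 by rewrite gt_eqF.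
rewrite [RHS]surjective_pairing /lerp; congr pair; apply: (mulIf sun).
  have -> : ((1 - dt u y / sq u) * x.1 + dt u y / sq u * u.1) * sq u =
     x.1 * sq u + (dt u y / sq u * sq u) * (u.1 - x.1) by ring.
  rewrite divfK//; apply/eqP; rewrite -subr_eq0.
  rewrite (_ : _ - _ = - (u.2 - x.2) * - orient x u y); last by rewrite /sq /dt /dotd /orient; ring.
  by rewrite o0 oppr0 mulr0.
have -> : ((1 - dt u y / sq u) * x.2 + dt u y / sq u * u.2) * sq u =
  x.2 * sq u + (dt u y / sq u * sq u) * (u.2 - x.2) by ring.
rewrite divfK//; apply/eqP; rewrite -subr_eq0.
rewrite (_ : _ - _ = (u.1 - x.1) * - orient x u y); last by rewrite /sq /dt /dotd /orient; ring.
by rewrite o0 oppr0 mulr0.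
Qed.

(* The complement of the two rays in a ball is covered by one sector and two half discs
   which overlap, all convex, and each ray bounds the sector and one of the half discs. *)
Lemma closure_pexterior_corner s x u1 u2 : 0 < orient x u1 u2 ->
  segment x u1 `<=` pboundary s -> segment x u2 `<=` pboundary s ->
  (\forall y \near x, pboundary s y -> segment x u1 y \/ segment x u2 y) ->
  closure (pexterior s) x ->
  \forall y \near x, pboundary s y -> closure (pexterior s) y.
Proof.
set D := orient x u1 u2 => D0 P1 P2 Prays cx.
pose al y := orient x y u2; pose be y := orient x u1 y.
(* [al y / D] and [be y / D] are the coordinates of [y] along [u1 - x] and [u2 - x]. Keeping them
   below 1 makes nearby points of a ray lie on its segment. *)
have : \forall y \near x, [/\ al y < D, be y < D &
    pboundary s y -> segment x u1 y \/ segment x u2 y].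
  near=> y; split; last by near: y.
    rewrite /al; suff : - D < orient x u2 y by rewrite [orient x u2 y]orientC; lra.
    near: y; have : \forall y \near x, 0 < (x.2 - u2.2) * y.1 + (u2.1 - x.1) * y.2 +
      (D - (x.2 - u2.2) * x.1 - (u2.1 - x.1) * x.2) by apply: affine_near_gt0; lra.
    by apply: filterS => y; rewrite /orient; lra.
  by near: y; exact: orient_near_lt.
move=> /nbhs_ballP[r /= r0 rB].
have alE y z l : al (lerp y z l) = (1 - l) * al y + l * al z by exact: orient_lerpl.
have beE y z l : be (lerp y z l) = (1 - l) * be y + l * be z by exact: orient_lerpr.
have alx : al x = 0 by rewrite /al /orient; ring.
have bex : be x = 0 by rewrite /be /orient; ring.
have ray1 y : segment x u1 y -> 0 <= al y /\ be y = 0.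
  move=> /segmentP[l l01 <-]; rewrite alE beE alx bex -/D /be.
  have -> : orient x u1 u1 = 0 by rewrite /orient; ring.
  by change (al u1) with D; split; nra.
have ray2 y : segment x u2 y -> al y = 0 /\ 0 <= be y.
  move=> /segmentP[l l01 <-]; rewrite alE beE alx bex -/D /al.
  have -> : orient x u2 u2 = 0 by rewrite /orient; ring.
  by change (be u2) with D; split; nra.
have notray y : ball x r y -> pboundary s y ->
    (0 <= al y /\ be y = 0) \/ (al y = 0 /\ 0 <= be y).
  by move=> /rB[_ _ h] /h[/ray1|/ray2]; [left|right].
pose S1 := [set y | [/\ ball x r y, 0 < al y & 0 < be y]].
pose S2 := [set y | ball x r y /\ 0 < - al y].
pose S3 := [set y | ball x r y /\ 0 < - be y].
have S1E y : S1 y -> pexterior s y -> S1 `<=` pexterior s.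
  apply: pexterior_convex => {}y.
    move=> z l l01 [By ay b_y] [Bz az bz]; split; [exact: ball_lerp|..].
      by rewrite alE; exact: conv_gt0.
    by rewrite beE; exact: conv_gt0.
  by move=> [By ay b_y] /(notray _ By)[[_ h]|[h _]]; move: ay b_y; rewrite h ltxx.
have S2E y : S2 y -> pexterior s y -> S2 `<=` pexterior s.
  apply: pexterior_convex => {}y.
    move=> z l l01 [By ay] [Bz az]; split; [exact: ball_lerp|].
    by have := conv_gt0 l01 ay az; rewrite alE; lra.
  by move=> [By ay] /(notray _ By)[[h _]|[h _]]; lra.
have S3E y : S3 y -> pexterior s y -> S3 `<=` pexterior s.
  apply: pexterior_convex => {}y.
    move=> z l l01 [By ay] [Bz az]; split; [exact: ball_lerp|].
    by have := conv_gt0 l01 ay az; rewrite beE; lra.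
  by move=> [By ay] /(notray _ By)[[_ h]|[_ h]]; lra.
have Bx := nbhsx_ballx x r r0.
(* [vp] is [x] plus both edge vectors, a direction inside the sector; [vm] is its mirror image in
   [x], a direction in the overlap of the half discs. *)
pose vp := (u1.1 + u2.1 - x.1, u1.2 + u2.2 - x.2).
pose vm := (x.1 *+ 3 - u1.1 - u2.1, x.2 *+ 3 - u1.2 - u2.2).
have [ep ep0 Bp] := nbhs_lerp vp Bx; have [em em0 Bm] := nbhs_lerp vm Bx.
have alp : 0 < al (lerp x vp ep).
  rewrite alE alx (_ : al vp = D); first by nra.
  by rewrite /al /D /orient /=; ring.
have bep : 0 < be (lerp x vp ep).
  rewrite beE bex (_ : be vp = D); first by nra.
  by rewrite /be /D /orient /=; ring.
have alm : 0 < - al (lerp x vm em).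
  rewrite alE alx (_ : al vm = - D); first by nra.
  by rewrite /al /D /orient /=; ring.
have bem : 0 < - be (lerp x vm em).
  rewrite beE bex (_ : be vm = - D); first by nra.
  by rewrite /be /D /orient /=; ring.
(* An exterior point near [x] is on neither ray, so some piece is exterior; a half disc passes this
   on to the other one through their overlap. *)
have cases : S1 `<=` pexterior s \/ (S2 `<=` pexterior s /\ S3 `<=` pexterior s).
  have [y [Ey By]] := cx _ Bx; have [lta ltb _] := rB _ By.
  have decomp : forall a b : R, al y = a * D -> be y = b * D ->
      y = (x.1 + a * (u1.1 - x.1) + b * (u2.1 - x.1), x.2 + a * (u1.2 - x.2) + b * (u2.2 - x.2)).
    move=> a b ya yb; have Dn : D != 0 by rewrite gt_eqF.
    rewrite [LHS]surjective_pairing; congr pair; apply: (mulIf Dn).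
      have -> : (x.1 + a * (u1.1 - x.1) + b * (u2.1 - x.1)) * D =
        x.1 * D + (a * D) * (u1.1 - x.1) + (b * D) * (u2.1 - x.1) by ring.
      by rewrite -ya -yb /al /be /D /orient; ring.
    have -> : (x.2 + a * (u1.2 - x.2) + b * (u2.2 - x.2)) * D =
      x.2 * D + (a * D) * (u1.2 - x.2) + (b * D) * (u2.2 - x.2) by ring.
    by rewrite -ya -yb /al /be /D /orient; ring.
  have yal : al y = al y / D * D by rewrite divfK// gt_eqF.
  have ybe : be y = be y / D * D by rewrite divfK// gt_eqF.
  have [a0|a0] := ltP (al y) 0.
    right; have S2s : S2 `<=` pexterior s by apply: (S2E y) => //; split=> //; lra.
    by split=> //; apply: (S3E (lerp x vm em)) => //; apply: S2s.
  have [b0|b0] := ltP (be y) 0.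
    right; have S3s : S3 `<=` pexterior s by apply: (S3E y) => //; split=> //; lra.
    by split=> //; apply: (S2E (lerp x vm em)) => //; apply: S3s.
  left; apply: (S1E y) => //; split=> //; rewrite lt_def ?a0 ?b0 andbT; apply/eqP => h0.
    case: Ey => + _; apply; apply: P2; apply/segmentP; exists (be y / D).
      by rewrite divr_ge0 ?(ltW D0)//= ler_pdivrMr// mul1r ltW.
    rewrite [in RHS](decomp 0 (be y / D)) ?h0 ?mul0r// /lerp.
    by congr pair; ring.
  case: Ey => + _; apply; apply: P1; apply/segmentP; exists (al y / D).
    by rewrite divr_ge0 ?(ltW D0)//= ler_pdivrMr// mul1r ltW.
  rewrite [in RHS](decomp (al y / D) 0) ?h0 ?mul0r// /lerp.
  by congr pair; ring.
apply/nbhs_ballP; exists r => //= z Bz Pz.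
have [_ _ /(_ Pz) zray] := rB _ Bz.
case: cases => [S1s|[S2s S3s]].
  apply: (@closure_lerp _ _ (lerp x vp ep)) => l l01; apply: S1s; split.
  - by apply: ball_lerp => //; lra.
  - by rewrite alE; apply: conv_gt0r => //; case: zray => [/ray1[]|/ray2[->]].
  - by rewrite beE; apply: conv_gt0r => //; case: zray => [/ray1[_ ->]|/ray2[]].
case: zray => [/ray1[_ z0]|/ray2[z0 _]];
  apply: (@closure_lerp _ _ (lerp x vm em)) => l l01.
  apply: S3s; split; first by apply: ball_lerp => //; lra.
  by rewrite beE z0; nra.
apply: S2s; split; first by apply: ball_lerp => //; lra.
by rewrite alE z0; nra.
Unshelve. all: by end_near. Qed.

(** For opposite rays the local pieces are the two half discs cut off by their common line. The
    exterior fills at least one, and both rays bound it. *)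
Lemma closure_pexterior_flat s x u1 u2 : orient x u1 u2 = 0 ->
  dotd x u1 u2 < 0 ->
  segment x u1 `<=` pboundary s -> segment x u2 `<=` pboundary s ->
  (\forall y \near x, pboundary s y -> segment x u1 y \/ segment x u2 y) ->
  closure (pexterior s) x ->
  \forall y \near x, pboundary s y -> closure (pexterior s) y.
Proof.
move=> D0 dot P1 P2 Prays cx.
pose be y := orient x u1 y.
pose dt := dotd x; pose sq u := dotd x u u.
have sq1 : 0 < sq u1.
  by apply: dotd_gt0 => u1x; move: dot; rewrite u1x /dotd !subrr !mul0r addr0 ltxx.
have sq2 : 0 < sq u2.
  by apply: dotd_gt0 => u2x; move: dot; rewrite u2x /dotd !subrr !mulr0 addr0 ltxx.
have dtn u : 0 < sq u -> \forall y \near x, dt u y < sq u.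
  move=> su; have : \forall y \near x, 0 < (x.1 - u.1) * y.1 + (x.2 - u.2) * y.2 +
    (sq u - (x.1 - u.1) * x.1 - (x.2 - u.2) * x.2) by apply: affine_near_gt0; lra.
  by apply: filterS => y; rewrite /dt /dotd; lra.
have : \forall y \near x, [/\ dt u1 y < sq u1, dt u2 y < sq u2 &
    pboundary s y -> segment x u1 y \/ segment x u2 y].
  by near=> y; split; near: y => //; exact: dtn.
move=> /nbhs_ballP[r /= r0 rB].
have beE y z l : be (lerp y z l) = (1 - l) * be y + l * be z by exact: orient_lerpr.
have bex : be x = 0 by rewrite /be /orient; ring.
have ray y : ball x r y -> pboundary s y -> be y = 0.
  move=> /rB[_ _ h] /h[]/segmentP[l l01 <-]; rewrite beE bex /be ?D0 ?mulr0 ?addr0//.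
  by rewrite /orient; ring.
pose S (e : R) := [set y | ball x r y /\ 0 < e * be y].
have SE e y : S e y -> pexterior s y -> S e `<=` pexterior s.
  apply: pexterior_convex => {}y.
    move=> z l l01 [By ay] [Bz az]; split; [exact: ball_lerp|].
    by have := conv_gt0 l01 ay az; rewrite beE; lra.
  by move=> [By ay] /(ray _ By) h; move: ay; rewrite h mulr0 ltxx.
have Bx := nbhsx_ballx x r r0.
have [e e0 Se] : exists2 e : R, e != 0 & S e `<=` pexterior s.
  have [y [Ey By]] := cx _ Bx; have [lta ltb _] := rB _ By.
  have [b0|b0|b0] := ltgtP (be y) 0.
  - by exists (-1); [lra | apply: (SE _ y) => //; split=> //; lra].
  - by exists 1; [lra | apply: (SE _ y) => //; split=> //; lra].
  exfalso; case: Ey => + _; apply; have [d0|d0] := leP 0 (dt u1 y).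
    apply: P1; apply/segmentP; exists (dt u1 y / sq u1); last exact: lerp_dotd.
    by rewrite divr_ge0 ?(ltW sq1)//= ler_pdivrMr// mul1r ltW.
  have o2 : orient x u2 y * sq u1 = 0.
    rewrite (_ : _ * _ = be y * dt u1 u2 - orient x u1 u2 * dt u1 y); first by rewrite b0 D0; ring.
    by rewrite /be /orient /sq /dt /dotd; ring.
  have {}o2 : orient x u2 y = 0.
    by move/eqP: o2; rewrite mulf_eq0 (gt_eqF sq1) orbF => /eqP.
  have d2 : 0 <= dt u2 y.
    have : dt u2 y * sq u1 = dt u1 u2 * dt u1 y.
      apply/eqP; rewrite -subr_eq0 (_ : _ - _ = be y * orient x u1 u2); first by rewrite b0 mul0r.
      by rewrite /be /orient /sq /dt /dotd; ring.
    have : dt u1 u2 < 0 by [].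
    by nra.
  apply: P2; apply/segmentP; exists (dt u2 y / sq u2); last exact: lerp_dotd.
  by rewrite divr_ge0 ?(ltW sq2)//= ler_pdivrMr// mul1r ltW.
(* [u1 - x] turned by a right angle and scaled by [e], so that the sign of [e] sends [v] towards the
   exterior half disc. *)
pose v := (x.1 - e * (u1.2 - x.2), x.2 + e * (u1.1 - x.1)).
have [em em0 Bm] := nbhs_lerp v Bx.
have e20 : 0 < e ^+ 2 by rewrite exprn_even_gt0.
apply/nbhs_ballP; exists r => //= z Bz Pz.
apply: (@closure_lerp _ _ (lerp x v em)) => l l01; apply: Se; split.
  by apply: ball_lerp => //; lra.
rewrite !beE (ray _ Bz Pz) bex (_ : be v = e * sq u1); last by rewrite /be /orient /sq /v /dotd /=; ring.
rewrite !mulr0 !add0r (_ : _ * _ = (l * em) * (e ^+ 2 * sq u1)); last by ring.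
by apply: mulr_gt0; apply: mulr_gt0 => //; lra.
Unshelve. all: by end_near. Qed.

(** The rays form a proper angle, are opposite, or coincide. In the last case the far end of the
    shorter segment would be a second common point. *)
Lemma closure_pexterior_near s x u1 u2 : u1 <> x -> u2 <> x ->
  (forall z, segment x u1 z -> segment x u2 z -> z = x) ->
  segment x u1 `<=` pboundary s -> segment x u2 `<=` pboundary s ->
  (\forall y \near x, pboundary s y -> segment x u1 y \/ segment x u2 y) ->
  closure (pexterior s) x ->
  \forall y \near x, pboundary s y -> closure (pexterior s) y.
Proof.
move=> u1x u2x meet P1 P2 Prays cx.
have [D0|D0|D0] := ltgtP (orient x u1 u2) 0; last first.
- have [dot|dot] := ltP (dotd x u1 u2) 0.
    exact: (closure_pexterior_flat D0 dot).
  exfalso; have sq1 := dotd_gt0 u1x; have sq2 := dotd_gt0 u2x.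
  have sqE : dotd x u1 u2 ^+ 2 = dotd x u1 u1 * dotd x u2 u2.
    apply/eqP; rewrite -subr_eq0 (_ : _ - _ = - orient x u1 u2 ^+ 2).
      by rewrite D0 expr0n oppr0.
    by rewrite /dotd /orient; ring.
  have endp u : segment x u u by apply/segmentP; exists 1; rewrite ?lerp1// ler01 lexx.
  have [le1|lt1] := leP (dotd x u1 u2) (dotd x u1 u1).
    apply: u2x; apply: meet => //; apply/segmentP; exists (dotd x u1 u2 / dotd x u1 u1).
      by rewrite divr_ge0 ?(ltW sq1)//= ler_pdivrMr// mul1r.
    exact: lerp_dotd.
  apply: u1x; apply: meet => //; apply/segmentP; exists (dotd x u2 u1 / dotd x u2 u2).
    by rewrite dotdC divr_ge0 ?(ltW sq2)//= ler_pdivrMr// mul1r; nra.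
  by apply: lerp_dotd => //; rewrite orientC D0 oppr0.
- exact: (closure_pexterior_corner D0).
- apply: (@closure_pexterior_corner s x u2 u1) => //; first by rewrite orientC; lra.
  by apply: filterS Prays => y h /h[]; [right|left].
Qed.

(** * Edges of a simple polygon near a boundary point *)

Lemma succ_modnE (n i : nat) : (i < n)%N -> (i.+1 %% n)%N = if i.+1 == n then 0%N else i.+1.
Proof. by move=> lin; case: eqP => [->|ne]; rewrite ?modnn// modn_small//; lia. Qed.

Lemma succ_modn_neq (n i : nat) : (1 < n)%N -> (i < n)%N -> ((i.+1 %% n)%N == i) = false.
Proof. by move=> n1 lin; apply/eqP; rewrite succ_modnE//; case: ifP => /eqP; lia. Qed.

Lemma pedge_start s i : pedge s i (nth origin s i).
Proof. by apply/segmentP; exists 0; rewrite ?lerp0// lexx ler01. Qed.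

Lemma pedge_end s i : pedge s i (nth origin s (i.+1 %% size s)).
Proof. by apply/segmentP; exists 1; rewrite ?lerp1// lexx ler01. Qed.

(** The finitely many edges that miss [x] have a closed union, which therefore misses a
    neighbourhood of [x]. *)
Lemma pedge_near s x : \forall y \near x,
  forall j, (j < size s)%N -> pedge s j y -> pedge s j x.
Proof.
pose F := [set j | (j < size s)%N /\ ~ pedge s j x].
have Fc : closed (\bigcup_(j in F) pedge s j).
  apply: closed_bigcup; last by move=> j _; exact: segment_closed.
  by apply: sub_finite_set (finite_II (size s)) => j [].
have : nbhs x (~` \bigcup_(j in F) pedge s j).
  by apply: open_nbhs_nbhs; split; [exact: closed_openC | move=> [j []]].
by apply: filterS => y ny j js jy; apply: contrapT => jx; apply: ny; exists j.
Qed.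

Lemma pedge_meet s i j x : simple_polygon s -> (i < size s)%N -> (j < size s)%N ->
  i <> j -> pedge s i x -> pedge s j x ->
  (j = (i.+1 %% size s)%N /\ x = nth origin s j) \/
  (i = (j.+1 %% size s)%N /\ x = nth origin s i).
Proof.
move=> [_ [_ simple]] is_ js ij ix jx.
have : (pedge s i `&` pedge s j) x by [].
rewrite (simple i j)//; case: eqP => [-> ->|_]; first by left.
by case: eqP => [-> ->|//]; right.
Qed.

Lemma closure_pexterior_vertex s j : simple_polygon s -> (j < size s)%N ->
  closure (pexterior s) (nth origin s j) ->
  \forall y \near nth origin s j, pboundary s y -> closure (pexterior s) y.
Proof.
move=> sp js; have [s3 [us _]] := sp; set x := nth origin s j.
pose i := if j == 0%N then (size s).-1 else j.-1.
have is_ : (i < size s)%N by rewrite /i; case: ifP => /eqP; lia.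
have ij : i <> j by rewrite /i; case: ifP => /eqP; lia.
have ji : (i.+1 %% size s)%N = j by rewrite succ_modnE// /i; do 2![case: ifP => /eqP]; lia.
have ns : (j.+1 %% size s < size s)%N by rewrite ltn_pmod//; lia.
apply: (@closure_pexterior_near s x (nth origin s (j.+1 %% size s)) (nth origin s i)).
- by move/eqP; rewrite /x nth_uniq// succ_modn_neq//; lia.
- by move/eqP; rewrite /x nth_uniq//; lia.
- move=> z; rewrite -/(pedge s j) segment_sym /x -[in segment _ _]ji -/(pedge s i) => zj zi.
  (* With at least three vertices the predecessor [i] of [j] is not its successor, so the two edges
     share only [x]. *)
  have [[_ ->]//|[+ _]] := pedge_meet sp is_ js ij zi zj.
  by rewrite succ_modnE// /i; do 2![case: ifP => /eqP]; lia.
- by move=> z zj; exists j.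
- by move=> z; rewrite segment_sym /x -[in segment _ _]ji => zi; exists i.
- apply: filterS (pedge_near s x) => y hy [k ks ky].
  have [kj|/eqP kj] := eqVneq k j; first by left; rewrite /x -kj.
  have [ki|/eqP ki] := eqVneq k i.
    by right; rewrite segment_sym /x -[in segment _ _]ji -ki.
  have xk := hy _ ks ky; have xj := pedge_start s j.
  have [[jk _]|[kj' xE]] := pedge_meet sp ks js kj xk xj.
    by exfalso; move: jk; rewrite succ_modnE// -ji succ_modnE//; do 2![case: ifP => /eqP]; lia.
  by exfalso; apply: kj; apply/eqP; rewrite -(nth_uniq origin ks js us); apply/eqP.
Qed.

Lemma segment_split a b (l m : R) : 0 < l < 1 -> 0 <= m <= 1 ->
  segment (lerp a b l) a (lerp a b m) \/ segment (lerp a b l) b (lerp a b m).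
Proof.
move=> l01 m01; have [ml|ml] := leP m l.
  left; apply/segmentP; exists (1 - m / l).
    by rewrite subr_ge0 lerBlDr lerDl ler_pdivrMr ?divr_ge0//; lra.
  have ln : l != 0 by lra.
  by rewrite /lerp /=; congr pair; field.
right; apply/segmentP; exists ((m - l) / (1 - l)).
  by rewrite divr_ge0 ?ler_pdivrMr//; lra.
have ln : 1 - l != 0 by lra.
by rewrite /lerp /=; congr pair; field.
Qed.

Lemma lerp_inj a b : a <> b -> injective (lerp a b).
Proof.
move=> ab l m /eqP; rewrite xpair_eqE => /andP[/eqP e1 /eqP e2].
have [d1|d1] := eqVneq a.1 b.1; last first.
  by rewrite eq_sym -subr_eq0 in d1; apply: (mulIf d1); lra.
have [d2|d2] := eqVneq a.2 b.2; last first.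
  by rewrite eq_sym -subr_eq0 in d2; apply: (mulIf d2); lra.
by case: ab; rewrite (surjective_pairing a) d1 d2 -surjective_pairing.
Qed.

Lemma lerp_lerpl a b (l m : R) : lerp (lerp a b l) a m = lerp a b (l * (1 - m)).
Proof. by rewrite /lerp /=; congr pair; ring. Qed.

Lemma lerp_lerpr a b (l m : R) : lerp (lerp a b l) b m = lerp a b (l + m * (1 - l)).
Proof. by rewrite /lerp /=; congr pair; ring. Qed.

(** A point inside an edge is treated as a vertex whose two edges are the two parts of that edge. *)
Lemma closure_pexterior_edge s i x : simple_polygon s -> (i < size s)%N -> pedge s i x ->
  (forall j, (j < size s)%N -> x <> nth origin s j) ->
  closure (pexterior s) x ->
  \forall y \near x, pboundary s y -> closure (pexterior s) y.
Proof.
move=> sp is_ ix nv; have [s3 [us _]] := sp.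
have ns : (i.+1 %% size s < size s)%N by rewrite ltn_pmod//; lia.
set a := nth origin s i; set b := nth origin s (i.+1 %% size s).
have ab : a <> b by move/eqP; rewrite /a /b nth_uniq// eq_sym succ_modn_neq//; lia.
have /segmentP[l l01 lx] := ix; rewrite -/a -/b in lx.
have l0 : l <> 0 by move=> l0; apply: (nv i) => //; rewrite -lx l0 lerp0.
have l1 : l <> 1 by move=> l1; apply: (nv (i.+1 %% size s)%N) => //; rewrite -lx l1 lerp1.
have {}l01 : 0 < l < 1.
  case/andP: l01 => h0 h1; rewrite !lt_def h0 h1 !andbT.
  by apply/andP; split; apply/eqP => // h; exact: l1.
apply: (@closure_pexterior_near s x a b).
- by apply/eqP; rewrite eq_sym; apply/eqP; exact: nv.
- by apply/eqP; rewrite eq_sym; apply/eqP; exact: nv.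
- move=> z /segmentP[m m01 <-] /segmentP[m' m'01]; rewrite -lx lerp_lerpl lerp_lerpr.
  move=> /(lerp_inj ab) E; have lm : l * m = 0 by clear -l01 m01 m'01 E; nra.
  by rewrite mulrBr mulr1 lm subr0.
- move=> z /segmentP[m m01 <-]; exists i => //; rewrite -lx lerp_lerpl.
  by apply/segmentP; exists (l * (1 - m)) => //; clear -l01 m01; nra.
- move=> z /segmentP[m m01 <-]; exists i => //; rewrite -lx lerp_lerpr.
  by apply/segmentP; exists (l + m * (1 - l)) => //; clear -l01 m01; nra.
- apply: filterS (pedge_near s x) => y hy [k ks ky].
  have [ki|/eqP ki] := eqVneq k i.
    move: ky; rewrite ki => /segmentP[m m01 <-]; rewrite -lx; exact: segment_split.
  have [[_ xE]|[_ xE]] := pedge_meet sp ks is_ ki (hy _ ks ky) ix.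
    by exfalso; exact: (nv i).
  by exfalso; exact: (nv k).
Qed.

(* The boundary points adherent to the exterior form a clopen part of each edge. *)
Lemma pboundary_sub_closure_pexterior s : simple_polygon s ->
  pboundary s `<=` closure (pexterior s).
Proof.
move=> sp; have [s3 [us _]] := sp.
have near_cl x : pboundary s x -> closure (pexterior s) x ->
    \forall y \near x, pboundary s y -> closure (pexterior s) y.
  move=> [i is_ ix] cx.
  have [[j js xj]|nv] := pselect (exists2 j, (j < size s)%N & x = nth origin s j).
    by rewrite xj in cx *; exact: closure_pexterior_vertex.
  by apply: (closure_pexterior_edge sp is_ ix) => // j js xj; apply: nv; exists j.
have edge_cl i x : (i < size s)%N -> pedge s i x -> closure (pexterior s) x ->
    pedge s i `<=` closure (pexterior s).
  move=> is_ ix cx; apply: (@segment_clopen _ _ _ _ _ x) => //; first exact: closed_closure.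
  move=> y iy cy; have : pboundary s y by exists i.
  by move=> /near_cl/(_ cy); apply: filterS => z hz iz; apply: hz; exists i.
have [x [i is_ ix] cx] : exists2 x, pboundary s x & closure (pexterior s) x.
  by apply: pboundary_closure_nonempty; lia.
have ms m : ((i + m) %% size s < size s)%N by rewrite ltn_pmod//; lia.
(* Consecutive edges share a vertex, so adherence is carried around the cycle from edge [i]. *)
have all_cl m : pedge s ((i + m) %% size s) `<=` closure (pexterior s).
  elim: m => [|m IH]; first by rewrite addn0 modn_small//; exact: edge_cl ix cx.
  have e : ((i + m.+1) %% size s = ((i + m) %% size s).+1 %% size s)%N.
    by rewrite addnS -[in RHS]addn1 modnDml addn1.
  apply: (edge_cl _ (nth origin s ((i + m.+1) %% size s))) => //; first exact: pedge_start.
  by apply: IH; rewrite e; exact: pedge_end.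
move=> y [j js jy]; apply: (all_cl (j + size s - i)%N).
by rewrite addnC subnK; [rewrite modnDr modn_small|lia].
Qed.

End PolygonFrontier.

(** * Visibility in a star-shaped polygon *)

Section StarShaped.
Variable R : realType.
Implicit Types (a b c d p q x y z : R * R) (s : seq (R * R)).

Lemma seesP s p q :
  sees s p q <-> forall l : R, 0 <= l <= 1 -> ~ pexterior s (lerp p q l).
Proof.
split=> [pq l l01 El|h].
  suff : (segment p q `&` pexterior s) (lerp p q l) by rewrite pq.
  by split=> //; apply/segmentP; exists l.
by rewrite /sees -subset0 => z [/segmentP[l l01 <-]]; exact: h.
Qed.

Lemma sees_sym s p q : sees s p q -> sees s q p.
Proof. by rewrite /sees segment_sym. Qed.

Variables (s : seq (R * R)) (o : R * R).
Hypothesis sp : simple_polygon s.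
Hypothesis ho : pregion s o.
Hypothesis star : forall p, pregion s p -> sees s o p.

Lemma pboundary_region p : pboundary s p -> pregion s p.
Proof. by move=> Pp [/(_ Pp)]. Qed.

(** Cramer's rule for [y - o] in the frame [a - o], [c - o]. *)
Lemma orient_decomp a c y : 0 < orient o a c ->
  y = (o.1 + orient o y c / orient o a c * (a.1 - o.1) + orient o a y / orient o a c * (c.1 - o.1),
       o.2 + orient o y c / orient o a c * (a.2 - o.2) + orient o a y / orient o a c * (c.2 - o.2)).
Proof.
move=> D0; set D := orient o a c in D0 *; have Dn : D != 0 by rewrite gt_eqF.
rewrite [LHS]surjective_pairing; congr pair; apply: (mulIf Dn).
  set k1 := orient o y c; set k2 := orient o a y.
  have -> : (o.1 + k1 / D * (a.1 - o.1) + k2 / D * (c.1 - o.1)) * D =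
    o.1 * D + (k1 / D * D) * (a.1 - o.1) + (k2 / D * D) * (c.1 - o.1) by ring.
  by rewrite !divfK// /k1 /k2 /D /orient; ring.
set k1 := orient o y c; set k2 := orient o a y.
have -> : (o.2 + k1 / D * (a.2 - o.2) + k2 / D * (c.2 - o.2)) * D =
  o.2 * D + (k1 / D * D) * (a.2 - o.2) + (k2 / D * D) * (c.2 - o.2) by ring.
by rewrite !divfK// /k1 /k2 /D /orient; ring.
Qed.

(** Unless [y] is [o], the ray from [o] through [y] meets the chord [a c] at parameter
    [ga / (al + ga)]. That point is in the region, hence seen from [o], and [y] lies on the segment
    from [o] to it. *)
Lemma sees_triangle a c y : sees s a c -> 0 < orient o a c ->
  0 <= orient o y c -> 0 <= orient o a y ->
  orient o y c + orient o a y <= orient o a c -> ~ pexterior s y.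
Proof.
move=> ac D0 y1 y2 le; rewrite (orient_decomp y D0).
set al := _ / _; set ga := orient o a y / _.
have al0 : 0 <= al by rewrite /al divr_ge0// ltW.
have ga0 : 0 <= ga by rewrite /ga divr_ge0// ltW.
have : al + ga <= 1 by rewrite /al /ga -mulrDl ler_pdivrMr// mul1r.
move: al ga al0 ga0 {y1 y2 le} => al ga al0 ga0 le1.
have [s0|s0] := leP (al + ga) 0.
  have -> : al = 0 by lra.
  have -> : ga = 0 by lra.
  by rewrite !mul0r !addr0 -surjective_pairing.
have sn : al + ga != 0 by rewrite gt_eqF.
have q01 : 0 <= ga / (al + ga) <= 1 by rewrite divr_ge0 ?ler_pdivrMr//; lra.
have /star/seesP : pregion s (lerp a c (ga / (al + ga))).
  by move/seesP: ac; apply.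
move=> /(_ (al + ga)) h; suff -> : (o.1 + al * (a.1 - o.1) + ga * (c.1 - o.1),
    o.2 + al * (a.2 - o.2) + ga * (c.2 - o.2)) =
    lerp o (lerp a c (ga / (al + ga))) (al + ga) by apply: h; lra.
by rewrite /lerp /=; congr pair; field.
Qed.

Lemma orient_neq_center a c : 0 < orient o a c -> a <> o.
Proof. by move=> + ao; rewrite ao /orient !subrr !mul0r subr0 ltxx. Qed.

Lemma orient_neq_centerr a c : 0 < orient o a c -> c <> o.
Proof. by move=> + ao; rewrite ao /orient !subrr !mulr0 subr0 ltxx. Qed.

(* A boundary point adheres to the exterior, so it cannot be interior to a triangle
   contained in the region. *)
Lemma pboundary_beyond_chord a b c : sees s a c -> 0 < orient o a c -> pboundary s b ->
  0 <= orient o a b -> 0 <= orient o b c ->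
  (orient o a b = 0 -> dotd o a a <= dotd o b b) ->
  (orient o b c = 0 -> dotd o c c <= dotd o b b) ->
  orient o a c <= orient o b c + orient o a b.
Proof.
move=> ac D0 Pb ab0 bc0 tie1 tie2.
have bE := orient_decomp b D0; have Na := dotd_gt0 (orient_neq_center D0).
have Nc := dotd_gt0 (orient_neq_centerr D0).
(* On the ray of [a] or of [c], relative to [o], the point [b] is [k] times that point, and the
   length hypothesis forces [k] to be at least 1. *)
have scale (k : R) u : b = (o.1 + k * (u.1 - o.1), o.2 + k * (u.2 - o.2)) -> 0 <= k ->
    0 < dotd o u u -> dotd o u u <= dotd o b b -> 1 <= k.
  move=> -> k0 u0; set w := (_, _).
  have -> : dotd o w w = k ^+ 2 * dotd o u u by rewrite /dotd /w /=; ring.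
  by rewrite ler_pMl// => k2; rewrite -(@expr_ge1 _ 2).
rewrite le_eqVlt in ab0; case/predU1P: ab0 => [ab0|ab0].
  rewrite -ab0 addr0; rewrite -[X in X <= _]mul1r -ler_pdivlMr//.
  apply: (scale _ a) => //; last exact: tie1.
    by rewrite [LHS]bE -ab0 !mul0r !addr0.
  by rewrite divr_ge0// ltW.
rewrite le_eqVlt in bc0; case/predU1P: bc0 => [bc0|bc0].
  rewrite -bc0 add0r; rewrite -[X in X <= _]mul1r -ler_pdivlMr//.
  apply: (scale _ c) => //; last exact: tie2.
    by rewrite [LHS]bE -bc0 !mul0r !addr0.
  by rewrite divr_ge0// ltW.
rewrite leNgt; apply/negP => inside.
have near_b : \forall y \near b, [/\ 0 < orient o a y, 0 < orient o y c &
    0 < orient o a c - orient o y c - orient o a y].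
  near=> y; split; near: y.
  - have : \forall y \near b, 0 < (o.2 - a.2) * y.1 + (a.1 - o.1) * y.2 +
      ((a.2 - o.2) * o.1 + (o.1 - a.1) * o.2).
      by apply: affine_near_gt0; move: ab0; rewrite /orient; lra.
    by apply: filterS => y; rewrite /orient; lra.
  - have : \forall y \near b, 0 < (c.2 - o.2) * y.1 + (o.1 - c.1) * y.2 +
      ((o.2 - c.2) * o.1 + (c.1 - o.1) * o.2).
      by apply: affine_near_gt0; move: bc0; rewrite /orient; lra.
    by apply: filterS => y; rewrite /orient; lra.
  - have : \forall y \near b, 0 < (a.2 - c.2) * y.1 + (c.1 - a.1) * y.2 +
      ((c.2 - a.2) * o.1 + (a.1 - c.1) * o.2 + orient o a c).
      by apply: affine_near_gt0; move: inside; rewrite /orient; lra.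
    by apply: filterS => y; rewrite /orient; lra.
have [e [Ee [e1 e2 e3]]] := pboundary_sub_closure_pexterior sp Pb near_b.
by apply: (sees_triangle (y := e) ac D0) => //; lra.
Unshelve. all: by end_near. Qed.

(** Seen from [o], [b] lies on or beyond the chord [a c], and [c] on or beyond [b d]. By the Plucker
    relation both then lie on or beyond the line [a d]. So the part of [a d] up to the direction of
    [c] is in the triangle [o a c], and the rest is in [o b d]. *)
Lemma sees_capped a b c d : pboundary s b -> pboundary s c ->
  0 < orient o a c -> 0 < orient o b d -> 0 < orient o b c -> 0 < orient o a d ->
  0 <= orient o a b -> (orient o a b = 0 -> dotd o a a <= dotd o b b) ->
  0 <= orient o c d -> (orient o c d = 0 -> dotd o d d <= dotd o c c) ->
  sees s a c -> sees s b d -> sees s a d.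
Proof.
move=> Pb Pc ac0 bd0 bc0 ad0 ab0 tie1 cd0 tie2 ac bd.
have H1 : orient o a c <= orient o b c + orient o a b.
  by apply: pboundary_beyond_chord => //; lra.
have H2 : orient o b d <= orient o c d + orient o b c.
  by apply: pboundary_beyond_chord => //; lra.
have plucker : orient o a d * orient o b c =
    orient o a c * orient o b d - orient o a b * orient o c d.
  by rewrite /orient; ring.
apply/seesP => m m01.
have pc : orient o (lerp a d m) c = (1 - m) * orient o a c - m * orient o c d.
  by rewrite /orient /=; ring.
have ap : orient o a (lerp a d m) = m * orient o a d by rewrite /orient /=; ring.
have pd : orient o (lerp a d m) d = (1 - m) * orient o a d by rewrite /orient /=; ring.
have bp : orient o b (lerp a d m) = m * orient o b d - (1 - m) * orient o a b.
  by rewrite /orient /=; ring.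
move: (lerp a d m) pc ap pd bp => p pc ap pd bp.
have [pc0|pc0] := leP 0 (orient o p c).
  apply: (sees_triangle ac ac0 pc0); rewrite ?pc ap; first by nra.
  have : orient o a d <= orient o a c + orient o c d.
    rewrite -(ler_pM2r bc0) plucker; nra.
  by nra.
apply: (sees_triangle bd bd0); rewrite ?pd ?bp; first by nra.
  (* A point of [a d] past the direction of [c] is also past that of [b]: multiplied by
     [orient o a c], this follows from the Plucker relation. *)
  rewrite -(pmulr_rge0 _ ac0).
  have : orient o a b * orient o c d <= orient o a c * orient o b d by nra.
  by rewrite pc in pc0; nra.
have : orient o a d <= orient o b d + orient o a b.
  rewrite -(ler_pM2r bc0) plucker; nra.
by nra.
Qed.

(** In multiples of [u - o], the points sit at [al] and [be]. Any value between these two lies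
    between 0 and one of them, so the segment [p q] is covered by the segments from [o] to [p] and
    to [q]. *)
Lemma sees_line (u p q : R * R) : u <> o -> pregion s p -> pregion s q ->
  orient o u p = 0 -> orient o u q = 0 -> sees s p q.
Proof.
move=> uo /star/seesP hp /star/seesP hq up uq; have N0 := dotd_gt0 uo.
have := lerp_dotd up N0; have := lerp_dotd uq N0.
set be := _ / _; set al := dotd o u p / _ => qE pE.
apply/seesP => l l01.
have pqE : lerp p q l = lerp o u ((1 - l) * al + l * be).
  by rewrite -pE -qE /lerp /=; congr pair; ring.
have scaled (k m : R) r : lerp o u k = r ->
    (forall l : R, 0 <= l <= 1 -> ~ pexterior s (lerp o r l)) ->
    (0 <= m <= k) || (k <= m <= 0) -> ~ pexterior s (lerp o u m).
  move=> <- hr mk; have [->|m0] := eqVneq m 0; first by rewrite lerp0.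
  have kn : k != 0.
    by apply: contra_neq m0 => k0; case/orP: mk; rewrite k0 -eq_le => /eqP.
  have -> : lerp o u m = lerp o (lerp o u k) (m / k).
    by rewrite /lerp /=; congr pair; field.
  apply: hr; case/orP: mk => /andP[m1 m2].
    have k0 : 0 < k by rewrite lt_def kn (le_trans m1).
    by rewrite divr_ge0 ?(ltW k0)//= ler_pdivrMr// mul1r.
  have k0 : k < 0 by rewrite lt_def eq_sym kn (le_trans m1).
  by rewrite ler_ndivrMr// mul1r m1 andbT mulr_le0// invr_le0 ltW.
rewrite pqE; set m := _ + _.
have [m1|m1] := leP 0 m.
  have [m2|m2] := leP m al; first by apply: (scaled _ _ _ pE hp); rewrite m1 m2.
  apply: (scaled _ _ _ qE hq); rewrite m1 /=; apply/orP; left; rewrite /m in m2 *.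
  have albe : al <= be by rewrite leNgt; apply/negP => lt; clear -l01 m2 lt; nra.
  by clear -l01 m2 albe; nra.
have [m2|m2] := leP al m; first by apply: (scaled _ _ _ pE hp); rewrite m2 (ltW m1) orbT.
apply: (scaled _ _ _ qE hq); rewrite (ltW m1) andbT; apply/orP; right; rewrite /m in m2 *.
have albe : be <= al by rewrite leNgt; apply/negP => lt; clear -l01 m2 lt; nra.
by clear -l01 m2 albe; nra.
Qed.

End StarShaped.

(** * Counting visible pairs *)

Section HalfPlane.
Variable R : realDomainType.
Implicit Types p q r : R * R.

Definition cross p q : R := p.1 * q.2 - p.2 * q.1.

(** A half-open half-plane: with its antipode it partitions the nonzero vectors, so no vector on the
    cutting line is lost or counted twice. *)
Definition upper p := (0 < p.2) || ((p.2 == 0) && (0 < p.1)).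

(** The Plucker relation for [p], [q], [r] and the fourth vector [(1, 0)]. *)
Lemma cross_plucker p q r : q.2 * cross p r = r.2 * cross p q + p.2 * cross q r.
Proof. by rewrite /cross; ring. Qed.

(** The coefficients in [cross_plucker] are nonnegative on [upper]; vectors on the horizontal axis,
    where a coefficient vanishes, are treated separately. *)
Lemma upper_cross_trans p q r : upper p -> upper q -> upper r ->
  0 <= cross p q -> 0 <= cross q r ->
  0 <= cross p r /\ (0 < cross p q \/ 0 < cross q r -> 0 < cross p r).
Proof.
move=> up uq ur pq qr; have pl := cross_plucker p q r.
have up0 : 0 <= p.2 by case/orP: up => [/ltW|/andP[/eqP->]].
have ur0 : 0 <= r.2 by case/orP: ur => [/ltW|/andP[/eqP->]].
case/orP: uq => [q0|/andP[/eqP q0 q1]].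
  have pr : 0 <= q.2 * cross p r by rewrite pl; nra.
  split; first by rewrite -(pmulr_rge0 _ q0).
  move=> st; rewrite -(pmulr_rgt0 _ q0) pl.
  case: st => st.
    case/orP: ur => [r0|/andP[/eqP r0 r1]]; first by nra.
    by move: qr; rewrite /cross r0; nra.
  case/orP: up => [p0|/andP[/eqP p0 p1]]; first by nra.
  case/orP: ur => [r0|/andP[/eqP r0 r1]]; last by move: qr; rewrite /cross r0; nra.
  by have := mulr_gt0 r0 (mulr_gt0 p1 q0); rewrite /cross p0; lra.
have p0 : p.2 = 0 by move: pq; rewrite /cross q0; nra.
have p1 : 0 < p.1 by move: up; rewrite /upper p0 ltxx eqxx.
move: pq qr; rewrite /cross p0 q0 => pq qr; split; first by nra.
by case=> st; nra.
Qed.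

(** Parallel vectors of equal length agree up to sign, and [upper] rules out the opposite sign. *)
Lemma upper_cross0_eq p q : upper p -> upper q -> cross p q = 0 ->
  p.1 ^+ 2 + p.2 ^+ 2 = q.1 ^+ 2 + q.2 ^+ 2 -> p = q.
Proof.
move=> up uq pq0 eqn.
have up0 : 0 <= p.2 by case/orP: up => [/ltW|/andP[/eqP->]].
have uq0 : 0 <= q.2 by case/orP: uq => [/ltW|/andP[/eqP->]].
have e2 : p.2 = q.2.
  have : (p.1 ^+ 2 + p.2 ^+ 2) * (p.2 ^+ 2 - q.2 ^+ 2) = 0.
    rewrite (_ : _ * _ = p.2 ^+ 2 * ((p.1 ^+ 2 + p.2 ^+ 2) - (q.1 ^+ 2 + q.2 ^+ 2)) -
      cross p q * (p.1 * q.2 + p.2 * q.1)); last by rewrite /cross; ring.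
    by rewrite eqn pq0 subrr mulr0 mul0r subr0.
  move/eqP; rewrite mulf_eq0 => /orP[|]; last first.
    by rewrite subr_eq0 eqrXn2// => /eqP.
  rewrite paddr_eq0 ?sqr_ge0// !sqrf_eq0 => /andP[/eqP z1 /eqP z2].
  by move: up; rewrite /upper z1 z2 ltxx andbF.
have e1 : p.1 = q.1.
  move: pq0; rewrite /cross -e2; case/orP: up => [p0|/andP[/eqP p0 p1] _].
    move=> h; apply: (mulIf (lt0r_neq0 p0)); apply/eqP; rewrite -subr_eq0.
    by rewrite [q.1 * _]mulrC h.
  move: uq eqn; rewrite /upper -e2 p0 ltxx eqxx /= => q1.
  rewrite expr0n /= !addr0 => /eqP; rewrite eqrXn2 ?ltW// => /eqP//.
by rewrite (surjective_pairing p) e1 e2 -surjective_pairing.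
Qed.

End HalfPlane.

Section Count.
Variable R : realType.
Variables (s : seq (R * R)) (o : R * R) (V : seq (R * R)) (t : nat).
Hypothesis sp : simple_polygon s.
Hypothesis ho : pregion s o.
Hypothesis star : forall p, pregion s p -> sees s o p.
Hypothesis uV : uniq V.
Hypothesis VP : forall v, v \in V -> pboundary s v.
Hypothesis noK : ~ vis_has_Ktt s V t.
Hypothesis t0 : (0 < t)%N.

Let I : finType := 'I_(size V).
Let w (i : I) : R * R := nth origin V i.
Let cr (i j : I) : R := orient o (w i) (w j).
Let N (i : I) : R := dotd o (w i) (w i).
Let vis (i j : I) : bool := `[< sees s (w i) (w j) >].
(** Each visible pair not on a line through [o] is oriented counterclockwise, through less than a
    half-turn. *)
Let E : rel I := fun i j => vis i j && (0 < cr i j).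

Let wP (i : I) : pboundary s (w i).
Proof. by apply: VP; rewrite mem_nth. Qed.

Let w_inj : injective w.
Proof. by move=> i j /eqP; rewrite nth_uniq// => /eqP/val_inj. Qed.

Let vis_sym (i j : I) : vis i j -> vis j i.
Proof. by move=> /asboolP ij; apply/asboolP; exact: sees_sym. Qed.

Let crC (i j : I) : cr i j = - cr j i.
Proof. exact: orientC. Qed.

Let crxx (i : I) : cr i i = 0.
Proof. by rewrite /cr /orient; ring. Qed.

Let E_free : biclique_free E t.
Proof.
move=> X Y cX cY XY; apply: noK; exists X, Y; split=> //.
  apply/setP => i; rewrite !inE; apply/negP => /andP[iX iY].
  by have := XY i i iX iY; rewrite /E crxx ltxx andbF.
by move=> i j iX jY; have /andP[/asboolP] := XY i j iX jY.
Qed.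

(** The centre is moved to the origin, and for [b = false] the plane is also reflected in it, so
    that [upper] describes both half-planes. *)
Let hv (b : bool) (i : I) : R * R :=
  if b then ((w i).1 - o.1, (w i).2 - o.2) else (o.1 - (w i).1, o.2 - (w i).2).
Let half (b : bool) : {set I} := [set i | upper (hv b i)]%SET.

Let cross_hv b i j : cross (hv b i) (hv b j) = cr i j.
Proof. by case: b; rewrite /cross /hv /cr /orient /=; ring. Qed.

Let cross_hvN b i j : cross (hv b i) (hv (~~ b) j) = cr j i.
Proof. by case: b; rewrite /cross /hv /cr /orient /=; ring. Qed.

Let half_trans b i j k : i \in half b -> j \in half b -> k \in half b ->
  0 <= cr i j -> 0 <= cr j k -> 0 <= cr i k /\ (0 < cr i j \/ 0 < cr j k -> 0 < cr i k).
Proof. by rewrite !inE -!(cross_hv b); exact: upper_cross_trans. Qed.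

Let half_eq b i j : i \in half b -> j \in half b -> cr i j = 0 -> N i = N j -> i = j.
Proof.
rewrite !inE -(cross_hv b) => ib jb ij Nij.
have hE : hv b i = hv b j.
  apply: upper_cross0_eq => //; move: Nij; rewrite /N /dotd /hv.
  by case: b {ib jb ij} => /=; lra.
apply: w_inj; rewrite (surjective_pairing (w i)) (surjective_pairing (w j)).
by move: hE; rewrite /hv; case: b {ib jb ij} => -[h1 h2]; congr pair; lra.
Qed.

(* Ties on a ray from the centre are broken so that [sees_capped] applies: the nearer point
   comes first in [nearer_first], last in [farther_first]. *)
Let nearer_first (i j : I) := (0 < cr i j) || ((cr i j == 0) && (N i < N j)).
Let farther_first (i j : I) := (0 < cr i j) || ((cr i j == 0) && (N j < N i)).

Let nearerP i j : nearer_first i j -> 0 <= cr i j /\ (cr i j = 0 -> N i <= N j).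
Proof.
case/orP => [h|/andP[/eqP h /ltW]]; last by rewrite h.
by split; [exact: ltW | move=> h0; move: h; rewrite h0 ltxx].
Qed.

Let fartherP i j : farther_first i j -> 0 <= cr i j /\ (cr i j = 0 -> N j <= N i).
Proof.
case/orP => [h|/andP[/eqP h /ltW]]; last by rewrite h.
by split; [exact: ltW | move=> h0; move: h; rewrite h0 ltxx].
Qed.

Let lex_irr (M : I -> R) i : ~~ ((0 < cr i i) || ((cr i i == 0) && (M i < M i))).
Proof. by rewrite crxx !ltxx andbF. Qed.

(** The tie-breaker [M] is left general: [N] gives [nearer_first], and [- N] gives
    [farther_first]. *)
Let lex_trans b (M : I -> R) :
  {in half b & &, transitive (fun i j => (0 < cr i j) || ((cr i j == 0) && (M i < M j)))}.
Proof.
move=> j i k jb ib kb ij jk.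
have ij0 : 0 <= cr i j by case/orP: ij => [/ltW//|/andP[/eqP->]].
have jk0 : 0 <= cr j k by case/orP: jk => [/ltW//|/andP[/eqP->]].
have [ik0 ik] := half_trans ib jb kb ij0 jk0.
case/orP: ij => [h|/andP[/eqP h1 M1]]; first by rewrite ik//; left.
case/orP: jk => [h|/andP[/eqP h2 M2]]; first by rewrite ik//; right.
have kj0 : 0 <= cr k j by rewrite crC h2 oppr0.
have ji0 : 0 <= cr j i by rewrite crC h1 oppr0.
have [ki0 _] := half_trans kb jb ib kj0 ji0.
have -> : cr i k = 0 by move: ki0; rewrite (crC k); lra.
by rewrite ltxx eqxx (lt_trans M1 M2).
Qed.

Let lex_total b (M : I -> R) : (forall i j, M i = M j -> N i = N j) ->
  {in half b &, forall i j, i != j ->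
    ((0 < cr i j) || ((cr i j == 0) && (M i < M j))) ||
    ((0 < cr j i) || ((cr j i == 0) && (M j < M i)))}.
Proof.
move=> MN i j ib jb ij; rewrite (crC j i) oppr_gt0 oppr_eq0.
case: ltgtP => //= e; case: ltgtP => //= /MN Nij.
by rewrite (half_eq ib jb (esym e) Nij) eqxx in ij.
Qed.

Let k1 b := order_key nearer_first (half b).
Let k2 b := order_key farther_first (half b).
(** The reversed order: within a half-plane a longer edge ends later, whereas [capped_edges_le]
    expects a smaller key for its end. *)
Let k2' b := order_key (fun i j => farther_first j i) (half b).

Let near_irr b : {in half b, forall i, ~~ nearer_first i i}.
Proof. by move=> i _; exact: lex_irr. Qed.
Let near_trans b : {in half b & &, transitive nearer_first}.
Proof. exact: lex_trans. Qed.
Let near_total b : {in half b &, forall i j, i != j -> nearer_first i j || nearer_first j i}.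
Proof. exact: lex_total. Qed.
Let farE i j : farther_first i j = (0 < cr i j) || ((cr i j == 0) && (- N i < - N j)).
Proof. by rewrite ltrN2. Qed.
Let far_irr b : {in half b, forall i, ~~ farther_first i i}.
Proof. by move=> i _; rewrite farE; exact: (lex_irr (fun i => - N i)). Qed.
Let far_trans b : {in half b & &, transitive farther_first}.
Proof. by move=> j i k jb ib kb; rewrite !farE; exact: (@lex_trans b (fun i => - N i)). Qed.
Let far_total b : {in half b &, forall i j, i != j -> farther_first i j || farther_first j i}.
Proof.
move=> i j ib jb; rewrite !farE; apply: (@lex_total b (fun i => - N i)) => // i' j'; exact: oppr_inj.
Qed.

Let k1_lt b := order_key_lt (@near_irr b) (@near_trans b) (@near_total b).
Let k1_inj b := order_key_inj (@near_irr b) (@near_trans b) (@near_total b).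
Let k2_lt b := order_key_lt (@far_irr b) (@far_trans b) (@far_total b).
Let k2_inj b := order_key_inj (@far_irr b) (@far_trans b) (@far_total b).

Let k2'_trans b : {in half b & &, transitive (fun i j => farther_first j i)}.
Proof. by move=> j i k jb ib kb ij jk; exact: (far_trans jb kb ib jk ij). Qed.
Let k2'_total b : {in half b &, forall i j, i != j -> farther_first j i || farther_first i j}.
Proof. by move=> i j ib jb ij; rewrite orbC; exact: (far_total ib jb ij). Qed.
Let k2'_lt b := @order_key_lt _ (fun i j => farther_first j i) (half b)
  (@far_irr b) (@k2'_trans b) (@k2'_total b).
Let k2'_inj b := @order_key_inj _ (fun i j => farther_first j i) (half b)
  (@far_irr b) (@k2'_trans b) (@k2'_total b).

Let vis_capped a b c d : 0 < cr b c -> 0 < cr a d ->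
  nearer_first a b -> farther_first c d -> E a c -> E b d -> E a d.
Proof.
move=> bc ad /nearerP[ab tab] /fartherP[cd tcd] /andP[/asboolP vac ac] /andP[/asboolP vbd bd].
by rewrite /E ad andbT; apply/asboolP; exact: (sees_capped sp ho star (wP b) (wP c)).
Qed.

(** Lengthening the edge [q r] to [p u] stays within the half-plane, so [cr p u] is positive by
    transitivity alone. *)
Let same_half b : (edges_between E (half b) (half b) <= t * (#|half b| + #|half b|))%N.
Proof.
apply: (@capped_edges_le _ E _ _ (@k1 b) (@k2' b)) => //.
move=> p q r u pb qb rb ub; rewrite k1_lt// k2'_lt// => pq ru pr qu qr.
have /andP[_ qr0] := qr.
apply: (vis_capped (b := q) (c := r)) => //.
have [pq0 _] := nearerP pq; have [ru0 _] := fartherP ru.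
have [_ pr0] := half_trans pb qb rb pq0 (ltW qr0).
have pr1 : 0 < cr p r by apply: pr0; right.
by have [_] := half_trans pb rb ub (ltW pr1) ru0; apply; left.
Qed.

(** Reflect the other half-plane in [o]: an edge from [x] to [y] across the cut then says that the
    image of [y] precedes [x]. So the edge [q u] gives [cr q r] positive, as [r] precedes [u], and
    the edge [p0 u] gives [cr p u] positive, as [p0] precedes [p]. *)
Let opposite_half b :
  (edges_between E (half b) (half (~~ b)) <= t.*2 * (#|half b| + #|half (~~ b)|))%N.
Proof.
apply: (@nested_edges_le _ E _ _ (@k1 b) (@k2 (~~ b))) => //.
move=> p0 p q r u p0b pb qb rb ub; rewrite !k1_lt// k2_lt// => p0p pq ru p0u qu pr.
have [p0p0 _] := nearerP p0p; have [ru0 _] := fartherP ru.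
have /andP[_ p0u0] := p0u; have /andP[_ qu0] := qu.
apply: (vis_capped (b := q) (c := r)) => //.
- move: rb ub qb; rewrite !inE => rb ub qb.
  rewrite -(cross_hvN (~~ b)) negbK; rewrite -(cross_hvN (~~ b)) negbK in qu0.
  rewrite -(cross_hv (~~ b)) in ru0.
  by have [_] := upper_cross_trans rb ub qb ru0 (ltW qu0); apply; right.
- move: p0b pb ub; rewrite !inE => p0b pb ub.
  rewrite -(cross_hvN (~~ b)) negbK; rewrite -(cross_hvN (~~ b)) negbK in p0u0.
  rewrite -(cross_hv b) in p0p0.
  by have [_] := upper_cross_trans ub p0b pb (ltW p0u0) p0p0; apply; left.
Qed.

Let off_center i : w i <> o -> (i \in half true) || (i \in half false).
Proof.
move=> wo; rewrite !inE /upper /hv /=.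
have [h|h|h] := ltgtP (w i).2 o.2.
- by rewrite !subr_gt0 h !orbT.
- by rewrite !subr_gt0 h.
- rewrite h subrr ltxx eqxx /= !subr_gt0.
  by case: ltgtP => // h1; case: wo; rewrite [RHS]surjective_pairing h1 -h -surjective_pairing.
Qed.

Let oriented_edges : (#|[set p : I * I | E p.1 p.2]%SET| <= 12 * t * size V)%N.
Proof.
have cI (X : {set I}) : (#|X| <= size V)%N.
  by apply: leq_trans (max_card _) _; rewrite card_ord.
pose e b c := [set p in finset.setX (half b) (half c) | E p.1 p.2]%SET.
have : [set p : I * I | E p.1 p.2]%SET \subset
    (e true true :|: e false false :|: (e true false :|: e false true)).
  apply/fintype.subsetP => -[i j]; rewrite inE /= => ij; have /andP[_ cij] := ij.
  have := off_center (orient_neq_center cij); have := off_center (orient_neq_centerr cij).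
  by rewrite !inE /= ij !andbT => /orP[]-> /orP[]->; rewrite ?orbT.
move/subset_leq_card/leq_trans; apply.
have mono k (X Y : {set I}) : (k * (#|X| + #|Y|) <= k * (size V + size V))%N.
  by rewrite leq_mul2l leq_add ?orbT.
have e1 b : (#|e b b| <= t * (size V + size V))%N := leq_trans (same_half b) (mono _ _ _).
have e2 b : (#|e b (~~ b)| <= t.*2 * (size V + size V))%N :=
  leq_trans (opposite_half b) (mono _ _ _).
have cU (X Y : {set I * I}) m n : (#|X| <= m)%N -> (#|Y| <= n)%N -> (#|X :|: Y| <= m + n)%N.
  by move=> Xm Yn; apply: leq_trans (leq_card_setU X Y) (leq_add Xm Yn).
(* With n = [size V]: the two classes within a half-plane have at most [2tn] edges each, the two
   across the cut at most [4tn] each. *)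
apply: leq_trans (cU _ _ _ _ (cU _ _ _ _ (e1 true) (e1 false))
                         (cU _ _ _ _ (e2 true) (e2 false))) _.
by lia.
Qed.

Let line_card i : w i <> o -> (#|[set j | cr i j == 0%R]%SET| <= t.*2)%N.
Proof.
move=> io; rewrite leqNgt; apply/negP => big.
set J := [set j | _]%SET in big.
have [X XJ cX] : exists2 X : {set I}, X \subset J & #|X| = t.
  by apply: exists_subset_card; lia.
have [Y YJ cY] : exists2 Y : {set I}, Y \subset J :\: X & #|Y| = t.
  apply: exists_subset_card; rewrite cardsD; have := subset_leq_card (subsetIr J X); lia.
apply: noK; exists X, Y; split=> //.
  apply/setP => j; rewrite !inE; apply/negP => /andP[jX /(fintype.subsetP YJ)].
  by rewrite inE jX.
move=> j k /(fintype.subsetP XJ) jJ /(fintype.subsetP YJ); rewrite inE => /andP[_ kJ].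
move: jJ kJ; rewrite !inE => /eqP jJ /eqP kJ.
by apply: (sees_line ho star io) => //; exact: pboundary_region (wP _).
Qed.

(** These are ordered pairs, diagonal included. A point of [V] at [o] is collinear with everything
    and fills a row of up to [size V], but there is at most one such point; every other row has at
    most [2t] entries. *)
Let collinear_pairs : (#|[set p : I * I | cr p.1 p.2 == 0%R]%SET| <= (t.*2 + 1) * size V)%N.
Proof.
pose C : rel I := fun i j => cr i j == 0.
have -> : #|[set p : I * I | cr p.1 p.2 == 0%R]%SET| = edges_between C [set: I]%SET [set: I]%SET.
  by apply: eq_card => p; rewrite !inE.
rewrite edges_between_row.
have -> : ((t.*2 + 1) * size V = \sum_(i in [set: I]%SET) t.*2 + size V)%N.
  by rewrite sum_nat_const cardsT card_ord; lia.
have [/existsP[i0 /eqP wi0]|/existsPn none] := boolP [exists i, w i == o].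
  rewrite (bigD1 i0) ?inE//= addnC leq_add//; last first.
    by apply: leq_trans (max_card _) _; rewrite card_ord.
  rewrite [leqRHS](bigD1 i0) ?inE//=; apply: leq_trans (leq_addl _ _); apply: leq_sum => i /andP[_ ii0].
  apply: leq_trans (line_card (i := i) _).
    by apply: subset_leq_card; apply/fintype.subsetP => j; rewrite !inE.
  by move=> wi; move/eqP: ii0; apply; apply: w_inj; rewrite wi wi0.
apply: leq_trans (leq_addr _ _); apply: leq_sum => i _.
apply: leq_trans (line_card (i := i) _); last exact/eqP.
by apply: subset_leq_card; apply/fintype.subsetP => j; rewrite !inE.
Qed.

(** A visible pair off the lines through [o] is in [F] or in its transpose, at most [12tn] each with
    n = [size V]; collinear pairs add at most [(2t + 1)n]. *)
Lemma vis_edges_le : (vis_edges s V <= (26 * t + 1) * size V)%N.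
Proof.
pose F := [set p : I * I | E p.1 p.2]%SET; pose sw (p : I * I) := (p.2, p.1).
pose Z := [set p : I * I | cr p.1 p.2 == 0%R]%SET.
have csw : #|sw @^-1: F| = #|F| by apply: on_card_preimset; exists sw => -[].
have sub : (vis_edges s V <= #|F :|: sw @^-1: F :|: Z|)%N.
  apply: subset_leq_card; apply/fintype.subsetP => -[i j]; rewrite !inE /= => /andP[_ vij].
  rewrite -/(vis i j) in vij; rewrite /E vij (vis_sym vij) /= (crC j i) oppr_gt0.
  by case: ltgtP.
apply: leq_trans sub _.
have := collinear_pairs; have := oriented_edges; rewrite -/F -/Z.
move=> cF cZ; apply: leq_trans (leq_card_setU _ _) _.
apply: leq_trans (leq_add (leq_card_setU _ _) cZ) _; rewrite csw.
by lia.
Qed.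

End Count.

Unset Implicit Arguments.

Theorem theorem1p2 (t : nat) : (0 < t)%N ->
  exists C : nat, forall (R : realType) (s V : seq (R * R)),
    simple_polygon s -> star_shaped s ->
    uniq V -> (forall v, v \in V -> pboundary s v) ->
    ~ vis_has_Ktt s V t ->
    (vis_edges s V <= C * size V)%N.
Proof.
move=> t0; exists (26 * t + 1)%N => R s V sp [c hc star] uV VP noK.
exact: (vis_edges_le sp hc star uV VP noK t0).
Qed.
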